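(* Let $t\ge2$, let $n$ be a positive integer and let $\lambda$ be a partition of length at most $nt$. Then $\varphi_t\,\mathrm{o}_\lambda=0$ unless $t\text{-core}(\lambda)$ is orthogonal, in which case \[ \varphi_t\mathrm{o}_\lambda=(-1)^{\varepsilon^{\mathrm{o}}_{\lambda;nt}}\,\mathrm{sgn}(w_t(\lambda;nt))\,\mathrm{o}_{\lambda^{(0)}}\prod_{r=1}^{\lfloor(t-1)/2\rfloor}\mathrm{rs}_{\lambda^{(r)},\lambda^{(t-r)}}\times\begin{cases}\mathrm{so}^-_{\lambda^{(t/2)}}&t\text{ even},\\1&t\text{ odd},\end{cases} \] where \[ \varepsilon^{\mathrm{o}}_{\lambda;nt}=\sum_{r=\lfloor(t+2)/2\rfloor}^{t-1}\binom{m_r(\lambda;nt)+1}{2}+\mathrm{rk}(t\text{-core}(\lambda))+\begin{cases}\binom{n+1}{2}+n\,\mathrm{rk}(t\text{-core}(\lambda))&t\text{ even},\\0&t\text{ odd}.\end{cases} \]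
   Context: $\Lambda$ is the ring of symmetric functions in countably many variables; $h_r$ are the complete homogeneous symmetric functions, with $h_0=1$ and $h_r=0$ for $r<0$. For $t\ge2$, $\varphi_t:\Lambda\to\Lambda$ is the ring homomorphism with $\varphi_t h_r=h_{r/t}$ if $t\mid r$ and $\varphi_th_r=0$ otherwise. Skew Schur functions: $s_{\lambda/\mu}=\det_{1\le i,j\le N}(h_{\lambda_i-\mu_j-i+j})$ ($N\ge l(\lambda)$), and $s_{\lambda/\mu}=0$ if $\mu\not\subseteq\lambda$. Universal characters, for a partition $\lambda$ and any $N\ge l(\lambda)$: $\mathrm{o}_\lambda=\det_{1\le i,j\le N}(h_{\lambda_i-i+j}-h_{\lambda_i-i-j})$, $\mathrm{sp}_\lambda=\tfrac12\det_{1\le i,j\le N}(h_{\lambda_i-i+j}+h_{\lambda_i-i-j+2})$, $\mathrm{so}_\lambda=\det_{1\le i,j\le N}(h_{\lambda_i-i+j}+h_{\lambda_i-i-j+1})$, $\mathrm{so}^-_\lambda=\det_{1\le i,j\le N}(h_{\lambda_i-i+j}-h_{\lambda_i-i-j+1})$; and for partitions $\lambda,\mu$, $\mathrm{rs}_{\lambda,\mu}=\sum_\nu(-1)^{|\nu|}s_{\lambda/\nu}s_{\mu/\nu'}$ (sum over partitions $\nu$, $\nu'$ the conjugate). Frobenius rank $\mathrm{rk}(\lambda)$ is the number of $i$ with $\lambda_i\ge i$; Frobenius notation $\lambda=(a_1,\dots,a_k\mid b_1,\dots,b_k)$ with $k=\mathrm{rk}(\lambda)$, $a_i=\lambda_i-i$,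 $b_i=\lambda'_i-i$. $\lambda$ is orthogonal if $b_i=a_i-1$ for all $i$, symplectic if $b_i=a_i+1$ for all $i$. Beta sets, cores and quotients: for $N\ge l(\lambda)$ let $\beta(\lambda;N)=\{\lambda_i+N-i:1\le i\le N\}$ and $m_r(\lambda;N)$ the number of its elements $\equiv r\pmod t$. Writing the elements in class $r$ as $\xi^{(r)}_kt+r$, $\xi^{(r)}_1>\cdots>\xi^{(r)}_{m_r}\ge0$, the $t$-quotient $(\lambda^{(0)},\dots,\lambda^{(t-1)})$ has $\lambda^{(r)}_k=\xi^{(r)}_k-m_r(\lambda;N)+k$; it is always computed with $N$ a multiple of $t$ (here $N=nt$). The $t$-core: list the integers $kt+r$ ($0\le k\le m_r(\lambda;N)-1$) decreasingly as $\tilde\xi_1>\cdots>\tilde\xi_N$, and $t\text{-core}(\lambda)_i=\tilde\xi_i-N+i$. $w_t(\lambda;N)$ is the permutation which rearranges the decreasing list $(\lambda_1+N-1,\dots,\lambda_N)$ of $\beta(\lambda;N)$ so that residues mod $t$ are weakly increasing and, within each residue class, the entries decrease; $\mathrm{sgn}(w_t(\lambda;N))$ is its sign. *)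

(* Defs.v *)
From HB Require Import structures.
From mathcomp Require Import all_boot all_order all_algebra all_fingroup.
From mathcomp Require Import boolp.
From mathcomp Require Import mpoly.

Set Implicit Arguments.
Unset Strict Implicit.
Unset Printing Implicit Defensive.

Import Order.TTheory GRing.Theory Num.Theory.

Local Open Scope ring_scope.

(* A partition is the weakly decreasing sequence of its positive parts, so its
   length is [size la].  Parts are indexed from 0: [part la i] is the
   mathematical lambda_(i+1), and is 0 beyond the length. *)
Definition is_part (la : seq nat) : bool := sorted geq la && (0%N \notin la).

Definition part (la : seq nat) (i : nat) : nat := nth 0%N la i.

Definition conj_part (la : seq nat) : seq nat :=
  mkseq (fun j => count (fun x => (j < x)%N) la) (head 0%N la).

Definition part_incl (mu la : seq nat) : bool :=
  all (fun i => (part mu i <= part la i)%N) (iota 0 (size mu)).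

(* All partitions contained in la, without repetition: see [mem_subparts] and
   [subparts_uniq]. *)
Fixpoint subparts (la : seq nat) : seq (seq nat) :=
  if la is a :: la' then
    [::] :: [seq b :: nu | b <- iota 1 a,
                           nu <- [seq nu <- subparts la' | (head 0 nu <= b)%N]]
  else [:: [::]].

Definition frob_rank (la : seq nat) : nat :=
  count (fun i => (i < part la i)%N) (iota 0 (size la)).

Definition arm (la : seq nat) (i : nat) : nat := (part la i - i.+1)%N.
Definition leg (la : seq nat) (i : nat) : nat := (part (conj_part la) i - i.+1)%N.

(* b_i = a_i - 1 holds in the integers: it fails when a_i = b_i = 0. *)
Definition orthogonal_part (la : seq nat) : bool :=
  all (fun i => (leg la i).+1 == arm la i) (iota 0 (frob_rank la)).

Definition beta_seq (la : seq nat) (N : nat) : seq nat :=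
  mkseq (fun i => (part la i + (N - i.+1))%N) N.

Definition part_of_beta (s : seq nat) : seq nat :=
  [seq x <- mkseq (fun k => (nth 0%N s k - (size s - k.+1))%N) (size s)
  | (0 < x)%N].

Definition nb_res (t : nat) (la : seq nat) (N r : nat) : nat :=
  count (fun x => (x %% t == r)%N) (beta_seq la N).

Definition tquot (t : nat) (la : seq nat) (N r : nat) : seq nat :=
  part_of_beta [seq (x %/ t)%N | x <- beta_seq la N & (x %% t == r)%N].

Definition tcore (t : nat) (la : seq nat) (N : nat) : seq nat :=
  part_of_beta (sort geq
    [seq (k * t + r)%N | r <- iota 0 t, k <- iota 0 (nb_res t la N r)]).

(* Order of the rearranged beta set: residues weakly increasing, entries
   decreasing inside a residue class. *)
Definition res_lt (t : nat) : rel nat := fun x y =>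
  (x %% t < y %% t)%N || ((x %% t == y %% t)%N && (y < x)%N).

Definition rearranges (t : nat) (la : seq nat) (N : nat) (w : 'S_N) : bool :=
  [forall i : 'I_N, forall j : 'I_N, (i < j)%N ==>
     res_lt t (nth 0%N (beta_seq la N) (w i)) (nth 0%N (beta_seq la N) (w j))].

(* For a partition la this is the unique such w, the default 1 being never
   used: see [rearranges_exists] and [rearranges_unique]. *)
Definition wt (t : nat) (la : seq nat) (N : nat) : 'S_N :=
  odflt 1%g [pick w | rearranges t la w].

Lemma part_cons a la : is_part (a :: la) =
  [&& (0 < a)%N, (head 0%N la <= a)%N & is_part la].
Proof.
rewrite /is_part /= in_cons negb_or lt0n (eq_sym a) andbCA; congr (_ && _).
by case: la => [|b la] //=; rewrite -andbA.
Qed.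

Lemma part_incl_cons b nu a la :
  part_incl (b :: nu) (a :: la) = (b <= a)%N && part_incl nu la.
Proof. by rewrite /part_incl /= (iotaDl 1 0) all_map. Qed.

Lemma mem_subparts la nu : is_part la ->
  (nu \in subparts la) = is_part nu && part_incl nu la.
Proof.
elim: la nu => [|a la IH] nu laP.
  rewrite /= mem_seq1; case: nu => [|b nu] //.
  by rewrite part_cons /part_incl /= /part /=; case: b => [|b]; rewrite /= ?andbF.
move: laP; rewrite part_cons => /and3P[_ _ /IH{}IH].
case: nu => [|b nu]; first by rewrite /= in_cons eqxx.
rewrite /= in_cons /= part_cons part_incl_cons.
apply/allpairsPdep/idP => [[c [x [+ + [-> ->]]]]|].
  rewrite mem_iota mem_filter IH add1n ltnS.
  by move=> /andP[-> ->] /and3P[-> -> ->].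
move=> /andP[/and3P[b0 nub nuP] /andP[ba nula]]; exists b, nu; split=> //.
  by rewrite mem_iota b0 add1n ltnS.
by rewrite mem_filter nub IH nuP.
Qed.

Lemma subparts_uniq la : uniq (subparts la).
Proof.
elim: la => [|a la IH] //=; apply/andP; split.
  by apply/negP => /allpairsPdep[x [y []]].
apply: allpairs_uniq_dep; first exact: iota_uniq.
  by move=> b _; apply: filter_uniq.
by move=> [b x] [c y] _ _ /= [-> ->].
Qed.

Lemma beta_seq_sorted la N : is_part la -> sorted gtn (beta_seq la N).
Proof.
case/andP => laS _; apply/(sortedP 0%N) => i; rewrite size_mkseq => iN.
rewrite !nth_mkseq //; last exact: ltnW.
suff : (part la i.+1 <= part la i)%N.
  move=> le; rewrite /= (@leq_ltn_trans (part la i + (N - i.+2))) ?leq_add2r //.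
  by rewrite ltn_add2l ltn_sub2l.
rewrite /part; case: (ltnP i.+1 (size la)) => [iS|iS].
  exact: (sortedP 0%N laS).
by rewrite nth_default.
Qed.

Lemma res_lt_trans t : transitive (res_lt t).
Proof.
move=> y x z; rewrite /res_lt.
case/orP => [xy|/andP[/eqP -> xy]]; case/orP => [yz|/andP[/eqP yz zy]].
- by rewrite (ltn_trans xy).
- by rewrite -yz xy.
- by rewrite yz.
- by rewrite yz eqxx (ltn_trans zy) ?orbT.
Qed.

Lemma res_ltxx t x : res_lt t x x = false.
Proof. by rewrite /res_lt !ltnn andbF. Qed.

Lemma res_lt_total t x y : x != y -> res_lt t x y || res_lt t y x.
Proof. by rewrite /res_lt; case: ltngtP => //= _; case: ltngtP. Qed.

Lemma rearranges_exists t la N : is_part la ->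
  rearranges t la (wt t la N).
Proof.
move=> laP; rewrite /wt; case: pickP => [w //|no].
pose B : N.-tuple nat := [tuple of beta_seq la N].
pose le x y := (x == y) || res_lt t x y.
have leT : total le.
  move=> x y; rewrite /le; have [//|xy] := eqVneq x y.
  exact: res_lt_total.
have letr : transitive le.
  move=> y x z; rewrite /le => /predU1P[->//|xy] /predU1P[<-|yz].
    by rewrite xy orbT.
  by rewrite (res_lt_trans xy yz) orbT.
have uB : uniq B.
  apply: (sorted_uniq (leT := gtn)); last exact: beta_seq_sorted.
    by move=> y x z /= xy yz; exact: ltn_trans yz xy.
  by move=> x; exact: ltnn.
have : perm_eq (sort le B) B by rewrite perm_sort.
case/tuple_permP => w Ew; suff : rearranges t la w by rewrite no.
apply/forallP => i; apply/forallP => j; apply/implyP => ij.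
have E (k : 'I_N) : nth 0%N (sort le B) k = nth 0%N (beta_seq la N) (w k).
  by rewrite Ew nth_mktuple (tnth_nth 0%N).
rewrite -!E; have S := sort_sorted leT B.
have szS : size (sort le B) = N by rewrite size_sort size_tuple.
have := sorted_ltn_nth letr 0%N S; rewrite -/(sort le B) => H.
have := H i j; rewrite !inE szS => /(_ (ltn_ord i) (ltn_ord j) ij).
by rewrite /le nth_uniq ?sort_uniq ?szS // (ltn_eqF ij).
Qed.

Lemma rearranges_unique t la N (w1 w2 : 'S_N) :
  rearranges t la w1 -> rearranges t la w2 -> w1 = w2.
Proof.
move=> r1 r2; pose b (w : 'S_N) i := nth 0%N (beta_seq la N) (w i).
pose s w := [seq b w i | i <- enum 'I_N].
have sS w : rearranges t la w -> sorted (res_lt t) (s w).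
  move=> /forallP rw; rewrite sorted_map sorted_pairwise; last first.
    by move=> y x z; exact: res_lt_trans.
  have : pairwise (fun i j : 'I_N => (i < j)%N) (enum 'I_N).
    by rewrite -(pairwise_map val ltn) val_enum_ord -sorted_pairwise
       ?iota_ltn_sorted //; exact: ltn_trans.
  by apply: sub_pairwise => i j ij; have /forallP/(_ j)/implyP := rw i; apply.
have irr : irreflexive (res_lt t) by move=> x; exact: res_ltxx.
have Es : s w1 = s w2.
  apply: (irr_sorted_eq (@res_lt_trans t) irr (sS _ r1) (sS _ r2)) => x.
  by apply/mapP/mapP => -[i _ ->]; [exists (w2^-1 (w1 i))%g|exists (w1^-1 (w2 i))%g];
    rewrite ?mem_enum // /b permKV.
have b12 i : b w1 i = b w2 i by move/eq_in_map: Es; apply; rewrite mem_enum.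
have inj (w : 'S_N) : rearranges t la w -> injective (b w).
  move=> /forallP rw i j E; apply: val_inj; apply/eqP; move: E => /eqP.
  have H (k l : 'I_N) : (k < l)%N -> b w k != b w l.
    move=> kl; apply/eqP => E; have /forallP/(_ l)/implyP/(_ kl) := rw k.
    by rewrite -/(b w k) -/(b w l) E res_ltxx.
  by case: (ltngtP i j) => // ij /eqP E; have := H _ _ ij; rewrite E eqxx.
apply/permP => i; have := b12 i.
have -> : b w2 i = b w1 (w1^-1 (w2 i))%g by rewrite /b permKV.
by move/(inj _ r1) => E; rewrite [in LHS]E permKV.
Qed.

(* The ring Lambda of symmetric functions over int is the graded inverse limit
   of the rings of symmetric polynomials in n variables: an element is a
   sequence of symmetric polynomials f_n in n variables, of bounded degree, with
   f_(n+1)(x_1, ..., x_n, 0) = f_n(x_1, ..., x_n). *)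
Definition kill_last n (p : {mpoly int[n.+1]}) : {mpoly int[n]} :=
  p \mPo [tuple oapp (fun j : 'I_n => 'X_j) 0 (unlift ord_max i) | i < n.+1].

Definition symfun_axiom (f : forall n, {mpoly int[n]}) : Prop :=
  [/\ forall n, f n \is symmetric,
      forall n, kill_last (f n.+1) = f n
    & exists d, forall n, (msize (f n) <= d)%N].

Record symfun := SymFun {
  symfun_val :> forall n, {mpoly int[n]};
  symfunP : symfun_axiom symfun_val }.

Lemma symfun_eq (f g : symfun) : (forall n, f n = g n) -> f = g.
Proof.
case: f g => [f fP] [g gP] /= fg.
have E : f = g by apply: functional_extensionality_dep.
by case: _ / E gP => gP; congr SymFun; apply: Prop_irrelevance.
Qed.

HB.instance Definition _ := gen_eqMixin symfun.
HB.instance Definition _ := gen_choiceMixin symfun.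

Lemma symfun_zero_subproof : symfun_axiom (fun=> 0).
Proof.
split=> [n|n|]; [exact: rpred0|by rewrite /kill_last raddf0|].
by exists 0%N => n; rewrite msize0.
Qed.
Definition symfun_zero := SymFun symfun_zero_subproof.

Lemma symfun_one_subproof : symfun_axiom (fun=> 1).
Proof.
split=> [n|n|]; [exact: rpred1|by rewrite /kill_last comp_mpoly1|].
by exists 1%N => n; rewrite msize1.
Qed.
Definition symfun_one := SymFun symfun_one_subproof.

Lemma symfun_opp_subproof (f : symfun) : symfun_axiom (fun n => - f n).
Proof.
case: (symfunP f) => fs fk [d fd]; split=> [n|n|]; first by rewrite rpredN fs.
  by rewrite /kill_last raddfN; rewrite -(fk n).
by exists d => n; rewrite msizeN.
Qed.
Definition symfun_opp f := SymFun (symfun_opp_subproof f).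

Lemma symfun_add_subproof (f g : symfun) : symfun_axiom (fun n => f n + g n).
Proof.
case: (symfunP f) => fs fk [d fd]; case: (symfunP g) => gs gk [e ge].
split=> [n|n|]; first by rewrite rpredD ?fs ?gs.
  by rewrite /kill_last raddfD; rewrite -(fk n) -(gk n).
exists (maxn d e) => n; apply: leq_trans (msizeD_le _ _) _.
by rewrite geq_max !leq_max fd ge orbT.
Qed.
Definition symfun_add f g := SymFun (symfun_add_subproof f g).

Lemma symfun_mul_subproof (f g : symfun) : symfun_axiom (fun n => f n * g n).
Proof.
case: (symfunP f) => fs fk [d fd]; case: (symfunP g) => gs gk [e ge].
split=> [n|n|]; first by rewrite rpredM ?fs ?gs.
  by rewrite /kill_last rmorphM; rewrite -(fk n) -(gk n).
exists (d + e)%N => n.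
have [->|f0] := eqVneq (f n) 0; first by rewrite mul0r msize0.
have [->|g0] := eqVneq (g n) 0; first by rewrite mulr0 msize0.
by rewrite msizeM // (leq_trans (leq_pred _)) // leq_add.
Qed.
Definition symfun_mul f g := SymFun (symfun_mul_subproof f g).

Fact symfun_addA : associative symfun_add.
Proof. by move=> f g k; apply: symfun_eq => n /=; rewrite addrA. Qed.
Fact symfun_addC : commutative symfun_add.
Proof. by move=> f g; apply: symfun_eq => n /=; rewrite addrC. Qed.
Fact symfun_add0 : left_id symfun_zero symfun_add.
Proof. by move=> f; apply: symfun_eq => n /=; rewrite add0r. Qed.
Fact symfun_addN : left_inverse symfun_zero symfun_opp symfun_add.
Proof. by move=> f; apply: symfun_eq => n /=; rewrite addNr. Qed.

HB.instance Definition _ := GRing.isZmodule.Build symfun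
  symfun_addA symfun_addC symfun_add0 symfun_addN.

Fact symfun_mulA : associative symfun_mul.
Proof. by move=> f g k; apply: symfun_eq => n /=; rewrite mulrA. Qed.
Fact symfun_mulC : commutative symfun_mul.
Proof. by move=> f g; apply: symfun_eq => n /=; rewrite mulrC. Qed.
Fact symfun_mul1 : left_id symfun_one symfun_mul.
Proof. by move=> f; apply: symfun_eq => n /=; rewrite mul1r. Qed.
Fact symfun_mulDl : left_distributive symfun_mul symfun_add.
Proof. by move=> f g k; apply: symfun_eq => n /=; rewrite mulrDl. Qed.
Fact symfun_one_neq0 : symfun_one != symfun_zero.
Proof.
apply/eqP => /(congr1 (fun f : symfun => f 0%N)) /= /eqP.
by rewrite oner_eq0.
Qed.

HB.instance Definition _ := GRing.Zmodule_isComNzRing.Build symfun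
  symfun_mulA symfun_mulC symfun_mul1 symfun_mulDl symfun_one_neq0.

(* Complete homogeneous symmetric polynomial: the sum of all monomials of
   degree r in n variables. *)
Definition hpoly (r n : nat) : {mpoly int[n]} :=
  \sum_(m : 'X_{1..n < r.+1} | mdeg m == r) 'X_[m].

Lemma mcoeff_kill_last n (p : {mpoly int[n.+1]}) (m : 'X_{1..n}) :
  (kill_last p)@_m = p@_(mnmwiden m).
Proof.
rewrite [RHS](congr1 (mcoeff _) (mpolyE p)) /kill_last comp_mpolyEX.
rewrite !(raddf_sum (mcoeff _)) /=; apply: eq_bigr => k _.
rewrite !mcoeffZ; congr (_ * _).
rewrite comp_mpolyX big_ord_recr /= tnth_mktuple unlift_none /= mcoeffX.
set P := \prod_(i < n) _.
have -> : P = 'X_[[multinom k (widen_ord (leqnSn n) i) | i < n]].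
  rewrite mpolyXE_id; apply: eq_bigr => i _; rewrite tnth_mktuple mnmE.
  have -> : widen_ord (leqnSn n) i = lift ord_max i.
    by apply: val_inj; rewrite [LHS]/= [RHS]lift_max.
  by rewrite liftK.
have [k0|k0] := eqVneq (k ord_max) 0%N.
  rewrite k0 expr0 mulr1 mcoeffX -(inj_eq (@inj_mnmwiden n)).
  congr (_ == _)%:R; apply/mnmP => i.
  case: (unliftP ord_max i) => [j ->|->]; last by rewrite mnmwiden_ordmax k0.
  have -> : lift ord_max j = widen_ord (leqnSn n) j.
    by apply: val_inj; rewrite [LHS]lift_max.
  by rewrite mnmwiden_widen mnmE.
rewrite expr0n (negPf k0) mulr0 mcoeff0; case: eqP => // E.
by rewrite E mnmwiden_ordmax eqxx in k0.
Qed.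

Lemma mdeg_mnmwiden n (m : 'X_{1..n}) : mdeg (mnmwiden m) = mdeg m.
Proof.
rewrite !mdegE big_ord_recr /= mnmwiden_ordmax addn0.
by apply: eq_bigr => i _; rewrite mnmwiden_widen.
Qed.

Lemma mcoeff_hpoly r n (m : 'X_{1..n}) : (hpoly r n)@_m = (mdeg m == r)%:R.
Proof.
rewrite raddf_sum /=.
rewrite (eq_bigr (fun k : 'X_{1..n < r.+1} => (k == m :> 'X_{1..n})%:R)).
  have [mr|mr] := eqVneq (mdeg m) r; last first.
    rewrite big1 // => k /eqP kr; case: eqP => // km.
    by rewrite -km kr eqxx in mr.
  have mb : (mdeg m < r.+1)%N by rewrite mr.
  rewrite (bigD1 (BMultinom mb)) /= ?mr // eqxx big1 ?addr0 // => k /andP[_ km].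
  by case: eqP => // E; case/eqP: km; apply: val_inj.
by move=> k _; rewrite mcoeffX.
Qed.

Lemma hsym_subproof r : symfun_axiom (hpoly r).
Proof.
split=> [n|n|].
- apply/issymP => s; apply/mpolyP => m.
  by rewrite mcoeff_sym !mcoeff_hpoly mdeg_mperm.
- by apply/mpolyP => m; rewrite mcoeff_kill_last !mcoeff_hpoly mdeg_mnmwiden.
exists r.+1 => n; apply: leq_trans (mmeasure_sum _ _ _ _) _.
by apply/bigmax_leqP => m /eqP mr; rewrite [leqLHS]msizeX mr.
Qed.

Definition hsym (r : nat) : symfun := SymFun (hsym_subproof r).

Lemma hsym0 : hsym 0 = 1.
Proof.
apply: symfun_eq => n; apply/mpolyP => m.
by rewrite mcoeff_hpoly mcoeff1 mdeg_eq0.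
Qed.

Definition hsymz (k : int) : symfun := if k is Posz r then hsym r else 0.

(* The N x N determinants do not depend on N as long as N is at least the
   length of the partition; N is the length itself here.  Rows and columns are
   indexed from 0, so the usual indices are i.+1 and j.+1. *)
Definition skew_schur (la mu : seq nat) : symfun :=
  if part_incl mu la then
    \det (\matrix_(i < size la, j < size la)
      hsymz ((part la i)%:Z - (part mu j)%:Z - i.+1%:Z + j.+1%:Z))
  else 0.

Definition o_char (la : seq nat) : symfun :=
  \det (\matrix_(i < size la, j < size la)
    (hsymz ((part la i)%:Z - i.+1%:Z + j.+1%:Z)
     - hsymz ((part la i)%:Z - i.+1%:Z - j.+1%:Z))).

Definition som_char (la : seq nat) : symfun :=
  \det (\matrix_(i < size la, j < size la)
    (hsymz ((part la i)%:Z - i.+1%:Z + j.+1%:Z)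
     - hsymz ((part la i)%:Z - i.+1%:Z - j.+1%:Z + 1))).

(* The terms of the sum over all partitions nu vanish unless nu is contained
   in la. *)
Definition rs_char (la mu : seq nat) : symfun :=
  \sum_(nu <- subparts la)
    (-1) ^+ sumn nu * skew_schur la nu * skew_schur mu (conj_part nu).

Definition eps_o (t n : nat) (la : seq nat) : nat :=
  let N := (n * t)%N in
  let k := frob_rank (tcore t la N) in
  (\sum_((t + 2) %/ 2 <= r < t) 'C((nb_res t la N r).+1, 2) + k
   + if odd t then 0 else 'C(n.+1, 2) + n * k)%N.

(* Main.v *)
Require Import Defs.
From HB Require Import structures.
From mathcomp Require Import all_boot all_order all_algebra all_fingroup.
From mathcomp Require Import zify ring.

Set Implicit Arguments.
Unset Strict Implicit.
Unset Printing Implicit Defensive.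

Import GRing.Theory.
Local Open Scope ring_scope.

(* With N = nt, the character o_la is the N x N determinant whose entry in the
   row of the beta number x and in the column c (1 <= c <= N) is
   h_(x - N + c) - h_(x - N - c).  After phi_t this entry vanishes unless x is
   congruent to c or - c modulo t, so that, once the rows are sorted by residue
   (sign of w_t), the determinant splits into blocks: one for the residue 0, one
   for each pair of residues r and t - r, and one for t/2 if t is even.  The
   blocks are square exactly when m_0 = n and m_r + m_(t-r) = 2n for 0 < r < t,
   which says that the t-core is orthogonal.  The blocks of 0 and t/2 are the
   determinants of o and so^-; the Laplace expansion of the block of the pair
   along its m_r first rows, indexed by the partitions in an m_r x m_(t-r) box,
   is the sum defining rs. *)

(** * Determinants with labelled rows and columns *)

(** The computation handles lists of row and column labels instead of matrices: a block is a
    [filter] of both lists, and sizes such as m_r + m_(t-r) and 2n, which agree only under a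
    hypothesis, never have to be identified in a type.

    The real work is the sign. Besides w_t, it collects the inversions made by gathering the columns
    divisible by t, those made by gathering each pair of residues, the factor -1 taken out of each
    column congruent to r in the block of a pair, the negated rows of residue t - r, the sign of the
    Laplace expansion, and the reversal of the columns of the second minor, which makes the
    conjugate partition appear. The total is not epsilon itself; only the parities agree, once the
    rank of the core is expressed through the m_r.

    In the block of a pair the two residue classes of columns are interleaved. Indexed by suitable
    integers d they fill the interval from 1 - n to n, and the sets of columns chosen in the Laplace
    expansion are then read off from partitions in a box. *)

Lemma mkseq_cons T (b : nat -> T) k :
  mkseq b k.+1 = b 0%N :: mkseq (fun i => b i.+1) k.
Proof. by rewrite /mkseq /= (iotaDl 1 0) -map_comp. Qed.

Section SeqDet.
Variable R : comNzRingType.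

(* The sum of [(-1)^i F x_i s_i] over the entries of [s = x_0 .. x_k], where
   [s_i] is [s] without [x_i]. *)
Fixpoint altsum (F : nat -> seq nat -> R) (s : seq nat) : R :=
  if s is x :: s' then F x s' - altsum (fun z u => F z (x :: u)) s' else 0.

(* The determinant of the [f x y], with rows x in [s] and columns y in [c]; it
   is 0 when [s] and [c] have different sizes, so that a block decomposition
   with non-square blocks needs no special treatment. *)
Fixpoint sdet T (f : nat -> T -> R) (s : seq nat) (c : seq T) : R :=
  if c is y :: c' then altsum (fun z u => f z y * sdet f u c') s
  else (nilp s)%:R.

Lemma eq_in_altsum F G (s : seq nat) :
  (forall z u, z \in s -> {subset u <= s} -> (size u).+1 = size s ->
     F z u = G z u) -> altsum F s = altsum G s.
Proof.
elim: s F G => [//|x s IH] F G FG /=; congr (_ - _).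
  by apply: FG => //; [exact: mem_head | move=> z; rewrite inE orbC => ->].
apply: IH => z u zs us su; apply: FG => //=; last by rewrite su.
- by rewrite inE zs orbT.
- by move=> w; rewrite !inE => /orP[->//|/us ->]; rewrite orbT.
Qed.

Lemma altsum_mull a F s : altsum (fun z u => a * F z u) s = a * altsum F s.
Proof. by elim: s F => [|x s IH] F /=; rewrite ?mulr0 // IH mulrBr. Qed.

Lemma altsum0 s : altsum (fun _ _ => 0) s = 0.
Proof. by elim: s => //= x s ->; rewrite subr0. Qed.

Lemma altsum_add F G s :
  altsum (fun z u => F z u + G z u) s = altsum F s + altsum G s.
Proof. by elim: s F G => [|x s IH] F G /=; rewrite ?addr0 // IH; ring. Qed.

Lemma altsum_opp F s : altsum (fun z u => - F z u) s = - altsum F s.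
Proof.
rewrite -mulN1r -altsum_mull; apply: eq_in_altsum => z u _ _ _.
by rewrite mulN1r.
Qed.

Lemma altsum_sum (I : Type) (r : seq I) (F : I -> nat -> seq nat -> R) s :
  altsum (fun z u => \sum_(i <- r) F i z u) s = \sum_(i <- r) altsum (F i) s.
Proof.
elim: r => [|i r IH].
  rewrite big_nil -[RHS](altsum0 s); apply: eq_in_altsum => *.
  by rewrite big_nil.
rewrite big_cons -IH -altsum_add; apply: eq_in_altsum => *.
by rewrite big_cons.
Qed.

Lemma altsum_cat F s1 s2 : altsum F (s1 ++ s2) =
  altsum (fun z u => F z (u ++ s2)) s1 +
  (-1) ^+ size s1 * altsum (fun z u => F z (s1 ++ u)) s2.
Proof.
elim: s1 F => [|x s1 IH] F /=; first by rewrite add0r expr0 mul1r.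
by rewrite IH exprS; ring.
Qed.

(** Two entries can be removed in either order; once the earlier one is gone, the later one stands
    one place further left, which changes the sign. This is the antisymmetry of [sdet] in two
    adjacent columns. *)
Lemma altsum_swap (F : nat -> nat -> seq nat -> R) s :
  altsum (fun z u => altsum (F z) u) s =
  - altsum (fun z u => altsum (fun w => F w z) u) s.
Proof.
elim: s F => [|x s IH] F /=; first by rewrite oppr0.
have E (G : nat -> nat -> seq nat -> R) :
    altsum (fun z u => G z x u - altsum (fun w v => G z w (x :: v)) u) s =
    altsum (fun z u => G z x u) s -
    altsum (fun z u => altsum (fun w v => G z w (x :: v)) u) s.
  by rewrite altsum_add altsum_opp.
by rewrite (E F) (E (fun z w => F w z)) (IH (fun z w v => F z w (x :: v))); ring.
Qed.

Lemma eq_in_sdet (T : eqType) (f g : nat -> T -> R) s c :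
  {in s & c, forall x y, f x y = g x y} -> sdet f s c = sdet g s c.
Proof.
elim: c s => [//|y c IH] s fg /=; apply: eq_in_altsum => z u zs us _.
rewrite fg ?mem_head // IH // => x w /us xs wc; apply: fg => //.
by rewrite inE wc orbT.
Qed.

Lemma sdet_size T (f : nat -> T -> R) s c : size s != size c -> sdet f s c = 0.
Proof.
elim: c s => [|y c IH] s /=; first by case: s.
move=> sc; rewrite -(altsum0 s); apply: eq_in_altsum => z u _ _ su.
by rewrite IH ?mulr0 // -eqSS su.
Qed.

Lemma sdet_map_col T T' (g : T -> T') (f : nat -> T' -> R) s c :
  sdet f s (map g c) = sdet (fun x y => f x (g y)) s c.
Proof.
by elim: c s => [//|y c IH] s /=; apply: eq_in_altsum => z u _ _ _; rewrite IH.
Qed.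

Lemma sdet_move T (f : nat -> T -> R) s c1 y c2 :
  sdet f s (c1 ++ y :: c2) = (-1) ^+ size c1 * sdet f s (y :: c1 ++ c2).
Proof.
elim: c1 s => [|x c1 IH] s /=; first by rewrite mul1r.
under [LHS]eq_in_altsum => z u _ _ _ do rewrite IH mulrCA /=.
rewrite altsum_mull exprS mulN1r mulNr -mulrN; congr (_ * _).
under [LHS]eq_in_altsum => z u _ _ _ do rewrite -altsum_mull.
rewrite altsum_swap; congr (- _); apply: eq_in_altsum => z u _ _ _.
by rewrite -altsum_mull; apply: eq_in_altsum => w v _ _ _; rewrite mulrCA.
Qed.

Lemma sdet_rev T (f : nat -> T -> R) s c :
  sdet f s (rev c) = (-1) ^+ 'C(size c, 2) * sdet f s c.
Proof.
elim: c s => [|y c IH] s; first by rewrite /= mul1r.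
rewrite rev_cons -cats1 sdet_move cats0 size_rev /=.
under [in LHS]eq_in_altsum => z u _ _ _ do rewrite IH mulrCA.
by rewrite altsum_mull mulrA -exprD binS bin1 addnC.
Qed.

(** The form that matches a cofactor expansion along the first column: [bump i] skips the index i
    exactly as the minor does. *)
Lemma altsum_mkseq F a m : altsum F (mkseq a m.+1) =
  \sum_(i < m.+1) (-1) ^+ i * F (a i) (mkseq (fun k => a (bump i k)) m).
Proof.
elim: m F a => [|m IH] F a.
  by rewrite big_ord1 /= mul1r subr0.
have altS x s : altsum F (x :: s) = F x s - altsum (fun z u => F z (x :: u)) s.
  by [].
rewrite mkseq_cons altS IH [in RHS]big_ord_recl expr0 mul1r; congr (_ + _).
rewrite -sumrN; apply: eq_bigr => i _; rewrite exprS mulN1r mulNr.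
rewrite [in RHS]mkseq_cons; congr (- (_ * F _ (_ :: _))).
by apply: eq_mkseq => k; rewrite /bump /= addnS.
Qed.

Lemma sdet_mkseq T (f : nat -> T -> R) a b m :
  sdet f (mkseq a m) (mkseq b m) = \det (\matrix_(i < m, j < m) f (a i) (b j)).
Proof.
elim: m a b => [|m IH] a b; first by rewrite det_mx00.
rewrite (mkseq_cons b); set c := mkseq (fun _ => _) m.
rewrite [LHS](_ : _ = altsum (fun z u => f z (b 0%N) * sdet f u c)
  (mkseq a m.+1)) // altsum_mkseq.
rewrite (expand_det_col _ ord0); apply: eq_bigr => i _.
rewrite mxE mulrCA; congr (_ * _); rewrite /cofactor addn0; congr (_ * _).
rewrite (IH _ (fun j => b j.+1)); congr (\det _).
by apply/matrixP => k l; rewrite !mxE.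
Qed.

(* The number of pairs of entries in the wrong order when the entries that
   satisfy P should precede the others. *)
Fixpoint invs T (P : pred T) (s : seq T) : nat :=
  if s is x :: s' then ((if P x then 0 else count P s') + invs P s')%N else 0%N.

Lemma altsum_splitl (P : pred nat) g A B s :
  (forall z, ~~ P z -> g z = 0) ->
  altsum (fun z u => g z * ((-1) ^+ invs P u * A (filter P u)
                            * B (filter (predC P) u))) s =
  (-1) ^+ invs P s * altsum (fun z u => g z * A u) (filter P s)
  * B (filter (predC P) s).
Proof.
move=> g0; elim: s A B => [|x s IH] A B /=; first by rewrite mulr0 mul0r.
case: (boolP (P x)) => Px /=.
  rewrite add0n (IH (fun u => A (x :: u)) B); ring.
rewrite g0 // mul0r sub0r.
(* Putting back x, which fails P, creates [count P u] inversions. This number is the size of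
   [filter P u], so the sign is absorbed into A and the induction hypothesis applies. *)
under eq_in_altsum => z u _ _ _ do
  rewrite exprD (mulrC ((-1) ^+ count P u)) -size_filter
    -2!mulrA (mulrA _ _ (B _)) (mulrA (_ ^+ invs _ _)).
rewrite (IH (fun u => (-1) ^+ size u * A u) (fun u => B (x :: u))).
under eq_in_altsum => z u _ _ su.
  rewrite (_ : _ * _ = - (-1) ^+ count P s * (g z * A u)); last first.
    by rewrite -size_filter -su exprS; ring.
  over.
by rewrite altsum_mull exprD; ring.
Qed.

(** Only entries z failing P contribute. The place of z shifts by the number of P-entries before it,
    and its removal loses one inversion for each P-entry after it: together all of [count P s],
    whatever z is. *)
Lemma altsum_splitr (P : pred nat) g A B s :
  (forall z, P z -> g z = 0) ->
  altsum (fun z u => g z * ((-1) ^+ invs P u * A (filter P u)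
                            * B (filter (predC P) u))) s =
  (-1) ^+ invs P s * (-1) ^+ count P s * A (filter P s)
  * altsum (fun z u => g z * B u) (filter (predC P) s).
Proof.
move=> g0; elim: s A B => [|x s IH] A B /=; first by rewrite mulr0.
case: (boolP (P x)) => Px /=.
  rewrite g0 // mul0r sub0r !add0n (IH (fun u => A (x :: u)) B) exprS; ring.
under eq_in_altsum => z u _ _ _ do
  rewrite exprD (mulrC ((-1) ^+ count P u)) -size_filter
    -2!mulrA (mulrA _ _ (B _)) (mulrA (_ ^+ invs _ _)).
rewrite (IH (fun u => (-1) ^+ size u * A u) (fun u => B (x :: u))).
rewrite add0n exprD size_filter.
have ee : (-1) ^+ count P s * (-1) ^+ count P s = 1 :> R.
  by rewrite -expr2 sqrr_sign.
move: ((-1) ^+ count P s) ee => e ee.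
set T := altsum _ _; set a := A _; set b := B _; set i := _ ^+ _.
have -> : e * i * e * a * (g x * b - T) = e * e * (i * a * (g x * b - T)).
  by ring.
have -> : i * e * (e * a) * T = e * e * (i * a * T) by ring.
by rewrite ee; ring.
Qed.

Lemma sdet_split (T : eqType) (f : nat -> T -> R) (P : pred nat) (Q : pred T) s c :
  (forall x y, P x != Q y -> f x y = 0) ->
  sdet f s c = (-1) ^+ (invs P s + invs Q c)
    * sdet f (filter P s) (filter Q c)
    * sdet f (filter (predC P) s) (filter (predC Q) c).
Proof.
move=> f0; elim: c s => [|y c IH] s /=.
  rewrite addn0; elim: s => [|x s IHs] /=; first by rewrite !mulr1.
  by case: (P x); rewrite /= ?mulr0 // mul0r.
have -> : altsum (fun z u => f z y * sdet f u c) s =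
    (-1) ^+ invs Q c * altsum (fun z u => f z y *
       ((-1) ^+ invs P u * sdet f (filter P u) (filter Q c)
        * sdet f (filter (predC P) u) (filter (predC Q) c))) s.
  rewrite -altsum_mull; apply: eq_in_altsum => z u _ _ _.
  by rewrite IH exprD; ring.
case: (boolP (Q y)) => Qy /=.
  rewrite (@altsum_splitl P (f^~ y) (fun u => sdet f u (filter Q c))
    (fun u => sdet f u (filter (predC Q) c))); last first.
    by move=> z /negPf Pz; apply: f0; rewrite Pz Qy.
  by rewrite add0n exprD; ring.
rewrite (@altsum_splitr P (f^~ y) (fun u => sdet f u (filter Q c))
    (fun u => sdet f u (filter (predC Q) c))); last first.
  by move=> z Pz; apply: f0; rewrite Pz (negPf Qy).
rewrite -!size_filter !exprD /=.
(* The rows give the sign of [count P s], the columns that of [count Q c]. They agree if the first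
   block is square; otherwise both sides are 0. *)
have [E|/sdet_size->] := eqVneq (size (filter P s)) (size (filter Q c)).
  by rewrite E; ring.
by rewrite !(mulr0, mul0r).
Qed.

Lemma sdet_scale_col T (v : T -> R) (g : nat -> T -> R) s c :
  sdet (fun x y => v y * g x y) s c = \prod_(y <- c) v y * sdet g s c.
Proof.
elim: c s => [|y c IH] s /=; first by rewrite big_nil mul1r.
rewrite big_cons -altsum_mull; apply: eq_in_altsum => z u _ _ _.
by rewrite IH; ring.
Qed.

(* The list 0, 1, -1, 2, .. , 1 - n, n differs from 1 - n, .. , n by an even
   permutation, as every non-positive entry is preceded by an even number of
   entries, all larger. *)
Definition zigzag n : seq int :=
  flatten [seq [:: - k%:Z; k.+1%:Z] | k <- iota 0 n].

Lemma zigzagS n : zigzag n.+1 = zigzag n ++ [:: - n%:Z; n.+1%:Z].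
Proof.
by rewrite /zigzag -[in iota _ _]addn1 iotaD map_cat flatten_cat.
Qed.

Lemma sdet_zigzag (g : nat -> int -> R) s n c :
  sdet g s (zigzag n ++ c) =
  sdet g s (mkseq (fun k => 1 - n%:Z + k%:Z) n.*2 ++ c).
Proof.
elim: n c => [//|n IH] c; rewrite zigzagS -catA IH doubleS mkseq_cons mkseqS.
rewrite [in LHS]sdet_move size_mkseq -signr_odd odd_double mul1r.
congr (sdet g s _); rewrite /= cat_rcons; congr (_ :: _); first by lia.
by congr (_ ++ _ :: _); [apply: eq_mkseq => k|]; lia.
Qed.

(** * Partitions in a box and the Laplace expansion along the first rows *)

Fixpoint box (m : nat) : nat -> seq (seq nat) :=
  if m is m'.+1 then
    fix boxm p := if p is p'.+1 then
      [seq p :: nu | nu <- box m' p] ++ boxm p' else [:: [::]]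
  else fun=> [:: [::]].

Lemma boxn0 m : box m 0 = [:: [::]]. Proof. by case: m. Qed.

Lemma boxSS m p :
  box m.+1 p.+1 = [seq p.+1 :: nu | nu <- box m p.+1] ++ box m.+1 p.
Proof. by []. Qed.

Lemma mem_box m p nu : (nu \in box m p) =
  [&& is_part nu, (size nu <= m)%N & (head 0%N nu <= p)%N].
Proof.
elim: m p nu => [|m IHm] p nu.
  by rewrite /= mem_seq1; case: nu => //= a l; rewrite andbF.
elim: p nu => [|p IHp] nu.
  rewrite boxn0 mem_seq1; case: nu => // -[|a] l; last by rewrite /= !andbF.
  by rewrite part_cons.
rewrite boxSS mem_cat IHp; case: nu => [|a l]; first by rewrite orbT.
have -> : (a :: l \in [seq p.+1 :: nu | nu <- box m p.+1]) =
    (a == p.+1) && (l \in box m p.+1).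
  apply/mapP/andP => [[x xb [-> ->]]|[/eqP -> lb]]; first by rewrite eqxx.
  by exists l.
rewrite IHm !part_cons /=; case: (ltngtP a p.+1) => [ap|ap|->] /=.
- by have -> : (a <= p)%N by rewrite -ltnS.
- by rewrite [(a <= p)%N]leqNgt (ltnW ap) !andbF.
by rewrite ltnn !andbF orbF ?andbT; case: (is_part l); rewrite ?andbF ?andbT //= andbC.
Qed.

Lemma box_uniq m p : uniq (box m p).
Proof.
elim: m p => [//|m IHm] p; elim: p => [//|p IHp].
rewrite boxSS cat_uniq IHp andbT map_inj_uniq ?IHm => [|x y []//].
apply/hasPn => x; rewrite mem_box => /and3P[_ _ xp].
by apply/mapP => -[y _ E]; rewrite E /= ltnn in xp.
Qed.

Definition colen (nu : seq nat) (l : nat) : nat := count (fun x => (l < x)%N) nu.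

(* The partition nu in the m x p box, drawn as a lattice path, splits the
   interval [x0, x0 + m + p) into [boxcols] and its complement [boxcolsC]. *)
Definition boxcols (x0 : int) m p (nu : seq nat) : seq int :=
  mkseq (fun j => x0 + p%:Z + j%:Z - (part nu j)%:Z) m.
Definition boxcolsC (x0 : int) p (nu : seq nat) : seq int :=
  mkseq (fun l => x0 + l%:Z + (colen nu (p - l.+1))%:Z) p.

Lemma boxcolsSl x0 m p nu :
  boxcols x0 m.+1 p (p :: nu) = x0 :: boxcols (x0 + 1) m p nu.
Proof.
rewrite /boxcols mkseq_cons; congr (_ :: _); first by rewrite /part /=; lia.
by apply: eq_mkseq => j; rewrite /part /=; lia.
Qed.

Lemma boxcolsSr x0 m p nu : boxcols x0 m p.+1 nu = boxcols (x0 + 1) m p nu.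
Proof. by apply: eq_mkseq => j; lia. Qed.

Lemma boxcolsCSl x0 p nu : boxcolsC x0 p (p :: nu) = boxcolsC (x0 + 1) p nu.
Proof.
apply/eq_in_map => l; rewrite mem_iota /colen /= => lp.
by rewrite (_ : (p - l.+1 < p)%N) //; lia.
Qed.

Lemma part_le_head nu x : is_part nu -> x \in nu -> (x <= head 0%N nu)%N.
Proof.
case: nu => [//|a nu] /andP[/= H _]; rewrite inE => /predU1P[->//|].
by move: H; rewrite path_sortedE => [/andP[/allP + _]|? ? ? /= *]; [apply|lia].
Qed.

Lemma colen_eq0 nu l : is_part nu -> (head 0 nu <= l)%N -> colen nu l = 0%N.
Proof.
move=> nuP hl; apply/eqP; rewrite -leqn0 leqNgt -has_count -all_predC.
by apply/allP => x /(part_le_head nuP) /= xh; lia.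
Qed.

Lemma boxcolsCSr x0 p nu : is_part nu -> (head 0 nu <= p)%N ->
  boxcolsC x0 p.+1 nu = x0 :: boxcolsC (x0 + 1) p nu.
Proof.
move=> nuP hp; rewrite /boxcolsC mkseq_cons subSS subn0 colen_eq0 //.
congr (_ :: _); first by lia.
by apply: eq_mkseq => l; rewrite subSS; lia.
Qed.

(** The column x0 goes either to the rows [s1] or to the rows [s2]; this is the dichotomy by which
    [box] is built, the first part of nu being the full width p or less. For the m x p box, mp -
    |nu| counts the pairs in which a column of the second minor precedes one of the first, hence the
    sign. *)
Lemma sdet_laplace (f : nat -> int -> R) s1 s2 x0 :
  sdet f (s1 ++ s2) (mkseq (fun k => x0 + k%:Z) (size s1 + size s2)) =
  \sum_(nu <- box (size s1) (size s2))
    (-1) ^+ (size s1 * size s2 + sumn nu)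
    * sdet f s1 (boxcols x0 (size s1) (size s2) nu)
    * sdet f s2 (boxcolsC x0 (size s2) nu).
Proof.
move E : (size s1 + size s2)%N => k.
elim: k s1 s2 x0 E => [|k IH] s1 s2 x0 E.
  by case: s1 s2 E => [|//] [|//] _; rewrite big_seq1 /= !mulr1.
rewrite mkseq_cons /= altsum_cat.
have -> : mkseq (fun i => x0 + i.+1%:Z) k = mkseq (fun i => (x0 + 1) + i%:Z) k.
  by apply: eq_mkseq => i; lia.
set c := mkseq _ k.
have left m p : size s1 = m.+1 -> size s2 = p ->
    altsum (fun z u => f z (x0 + 0%:Z) * sdet f (u ++ s2) c) s1 =
    \sum_(nu <- box m p) (-1) ^+ (m * p + sumn nu)
     * sdet f s1 (x0 :: boxcols (x0 + 1) m p nu)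
     * sdet f s2 (boxcolsC (x0 + 1) p nu).
  move=> m1 p2; under eq_bigr => nu _ do rewrite [sdet f s1 _]/= mulrC 
    -!altsum_mull.
  rewrite -altsum_sum; apply: eq_in_altsum => z u _ _; rewrite m1 => -[um].
  rewrite IH; last by lia.
  rewrite um p2 big_distrr /=; apply: eq_bigr => nu _; rewrite addr0; ring.
have right m p : size s1 = m -> size s2 = p.+1 ->
    altsum (fun z u => f z (x0 + 0%:Z) * sdet f (s1 ++ u) c) s2 =
    \sum_(nu <- box m p) (-1) ^+ (m * p + sumn nu)
     * sdet f s1 (boxcols (x0 + 1) m p nu)
     * sdet f s2 (x0 :: boxcolsC (x0 + 1) p nu).
  move=> m1 p2; under eq_bigr => nu _ do rewrite [sdet f s2 _]/= -altsum_mull.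
  rewrite -altsum_sum; apply: eq_in_altsum => z u _ _; rewrite p2 => -[um].
  rewrite IH; last by lia.
  rewrite um m1 big_distrr /=; apply: eq_bigr => nu _; rewrite addr0; ring.
case m1: (size s1) => [|m]; case p2: (size s2) => [|p]; first by lia.
- rewrite (_ : altsum _ s1 = 0); last by rewrite (size0nil m1).
  rewrite add0r mul1r (right _ _ m1 p2) !big_seq1.
  by rewrite boxcolsCSr ?boxcolsSr.
- rewrite (_ : altsum _ s2 = 0); last by rewrite (size0nil p2).
  rewrite mulr0 addr0 (left _ _ m1 p2) !boxn0 !big_seq1 !muln0.
  congr (_ * sdet f s1 _ * _); rewrite /boxcols mkseq_cons.
  by congr (_ :: _); [|apply: eq_mkseq => j]; rewrite /part !nth_nil; lia.
rewrite (left _ _ m1 p2) (right _ _ m1 p2) boxSS big_cat big_map mulr_sumr.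
congr (_ + _); rewrite !big_seq; apply: eq_bigr => nu nub.
  rewrite boxcolsSl boxcolsCSl; congr (_ * _ * _).
  rewrite -signr_odd -[RHS]signr_odd /= !(oddD, oddM) /=.
  by case: (odd m); case: (odd p); case: (odd (sumn nu)).
rewrite mem_box in nub; case/and3P: nub => nuP _ nup.
rewrite boxcolsSr boxcolsCSr // 2!mulrA -exprD; congr (_ ^+ _ * _ * _).
lia.
Qed.
End SeqDet.

(** * Characters as determinants of larger size *)

(** The last row is 0 except for a final 1, so expanding along it lowers m by one. The rows beyond
    the length of the partition have this shape in all the characters, whose determinants are
    therefore independent of N. *)
Lemma det_unitriangular_tail (R : comNzRingType) (F : nat -> nat -> R) l m :
  (l <= m)%N ->
  (forall i j, (l <= i)%N -> (j <= i)%N -> F i j = (i == j)%:R) ->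
  \det (\matrix_(i < m, j < m) F i j) = \det (\matrix_(i < l, j < l) F i j).
Proof.
move=> lm F1; elim: m lm => [|m IH]; first by rewrite leqn0 => /eqP ->.
rewrite leq_eqVlt => /predU1P[->//|lm].
rewrite (expand_det_row _ ord_max) (bigD1 ord_max) //= big1 ?addr0 => [|j jm].
  rewrite mxE F1 // eqxx mul1r /cofactor -signr_odd oddD addbb mul1r -IH //.
  by congr (\det _); apply/matrixP => i j; rewrite !mxE !lift_max.
rewrite mxE F1 -1?ltnS //; case: eqP => [E|_]; last by rewrite mul0r.
by case/eqP: jm; apply: val_inj.
Qed.

(** Pigeonhole: a permutation cannot send the m - k indices from k on into the m - k - 1 indices
    beyond k, so every term of the determinant meets the zero block. *)
Lemma det_zero_block (R : comNzRingType) (F : nat -> nat -> R) k m :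
  (k < m)%N -> (forall i j, (k <= i)%N -> (j <= k)%N -> F i j = 0) ->
  \det (\matrix_(i < m, j < m) F i j) = 0.
Proof.
move=> km F0; rewrite /determinant big1 // => s _.
suff [i ki sk] : exists2 i : 'I_m, (k <= i)%N & (s i <= k)%N.
  by rewrite (bigD1 i) //= mxE F0 // mul0r mulr0.
pose K := [set i : 'I_m | (k <= i)%N].
have : ~~ (s @: K \subset K :\ Ordinal km).
  apply/negP => /subset_leq_card; rewrite card_imset; last exact: perm_inj.
  by rewrite (cardsD1 (Ordinal km) K) inE leqnn ltnn.
case/subsetPn => _ /imsetP[i iK ->]; rewrite !inE negb_and negbK -ltnNge => H.
exists i; first by rewrite inE in iK.
by case/orP: H => [/eqP -> //|/ltnW].
Qed.

Lemma hsymz_lt0 k : (k < 0)%R -> hsymz k = 0.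
Proof. by case: k. Qed.

Lemma hsymz_unit i j : (j <= i)%N -> hsymz (j%:Z - i%:Z) = (i == j)%:R.
Proof.
rewrite leq_eqVlt => /predU1P[->|ji]; first by rewrite subrr eqxx /= hsym0.
by rewrite hsymz_lt0 ?(gtn_eqF ji) //; lia.
Qed.

Lemma part_anti la i j : is_part la -> (i <= j)%N -> (part la j <= part la i)%N.
Proof.
case/andP => laS _ ij; rewrite /part.
case: (ltnP j (size la)) => [jl|jl]; last by rewrite nth_default.
have geqT : transitive geq by move=> y x z /= xy /leq_trans; apply.
have := @sorted_leq_nth _ geq geqT leqnn 0%N la laS i j.
by apply=> //; apply: leq_ltn_trans jl.
Qed.

Lemma part_default la i : (size la <= i)%N -> part la i = 0%N.
Proof. exact: nth_default. Qed.

Lemma ltn_part_size la i : is_part la -> (0 < part la i)%N = (i < size la)%N.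
Proof.
case/andP => _ la0; case: (ltnP i (size la)) => il; last by rewrite part_default.
by rewrite lt0n; apply: contraNneq la0 => <-; exact: mem_nth.
Qed.

Lemma part_inclP mu la :
  reflect (forall i, (part mu i <= part la i)%N) (part_incl mu la).
Proof.
apply: (iffP allP) => [H i|H i _]; last exact: H.
case: (ltnP i (size mu)) => il; last by rewrite part_default.
by apply: H; rewrite mem_iota.
Qed.

(** The convention that s is 0 without inclusion is consistent with the determinant: if mu_k > la_k,
    the entries in rows i >= k and columns j <= k are h of a negative index, a block too large for a
    non-zero determinant. *)
Lemma skew_schur_det la mu m : is_part la -> is_part mu ->
  (size la <= m)%N -> (size mu <= m)%N ->
  skew_schur la mu = \det (\matrix_(i < m, j < m)
    hsymz ((part la i)%:Z - (part mu j)%:Z - i.+1%:Z + j.+1%:Z)).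
Proof.
move=> laP muP lam mum; rewrite /skew_schur.
case: (boolP (part_incl mu la)) => [/part_inclP incl|nincl].
  apply/esym/(det_unitriangular_tail
    (F := fun i j => hsymz ((part la i)%:Z - (part mu j)%:Z - i.+1%:Z + j.+1%:Z)));
    first by [].
  move=> i j li ji; have la0 := part_default li; rewrite la0.
  case: (ltnP j (size la)) => [jl|jl].
    by rewrite hsymz_lt0 ?gtn_eqF //; lia.
  have := incl j; rewrite (part_default jl) leqn0 => /eqP ->.
  by rewrite -(hsymz_unit ji); congr hsymz; lia.
have /allPn[k] := nincl; rewrite mem_iota add0n -ltnNge => /andP[_ kl] muk.
apply/esym/(@det_zero_block _
  (fun i j => hsymz ((part la i)%:Z - (part mu j)%:Z - i.+1%:Z + j.+1%:Z)) k).
  exact: leq_trans mum.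
move=> i j ki jk; apply: hsymz_lt0.
by have := part_anti laP ki; have := part_anti muP jk; lia.
Qed.

Lemma o_char_det la m : is_part la -> (size la <= m)%N ->
  o_char la = \det (\matrix_(i < m, j < m)
    (hsymz ((part la i)%:Z - i.+1%:Z + j.+1%:Z)
     - hsymz ((part la i)%:Z - i.+1%:Z - j.+1%:Z))).
Proof.
move=> laP lam; apply/esym/(det_unitriangular_tail (F := fun i j =>
    (hsymz ((part la i)%:Z - i.+1%:Z + j.+1%:Z)
     - hsymz ((part la i)%:Z - i.+1%:Z - j.+1%:Z)))) => // i j li ji.
rewrite (part_default li) -(hsymz_unit ji).
by rewrite [X in _ - X]hsymz_lt0 ?subr0; [congr hsymz|]; lia.
Qed.

Lemma som_char_det la m : is_part la -> (size la <= m)%N ->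
  som_char la = \det (\matrix_(i < m, j < m)
    (hsymz ((part la i)%:Z - i.+1%:Z + j.+1%:Z)
     - hsymz ((part la i)%:Z - i.+1%:Z - j.+1%:Z + 1))).
Proof.
move=> laP lam; apply/esym/(det_unitriangular_tail (F := fun i j =>
    (hsymz ((part la i)%:Z - i.+1%:Z + j.+1%:Z)
     - hsymz ((part la i)%:Z - i.+1%:Z - j.+1%:Z + 1)))) => // i j li ji.
rewrite (part_default li) -(hsymz_unit ji).
by rewrite [X in _ - X]hsymz_lt0 ?subr0; [congr hsymz|]; lia.
Qed.

Lemma size_conj_part nu : size (conj_part nu) = head 0%N nu.
Proof. exact: size_mkseq. Qed.

Lemma part_conj nu l : is_part nu -> part (conj_part nu) l = colen nu l.
Proof.
move=> nuP; case: (ltnP l (head 0%N nu)) => hl.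
  by rewrite /part nth_mkseq.
by rewrite part_default ?size_conj_part // colen_eq0.
Qed.

Lemma colen_anti nu i j : (i <= j)%N -> (colen nu j <= colen nu i)%N.
Proof. by move=> ij; apply: sub_count => x /=; apply: leq_ltn_trans. Qed.

Lemma conj_part_is_part nu : is_part nu -> is_part (conj_part nu).
Proof.
move=> nuP; apply/andP; split.
  apply/(sortedP 0%N) => i; rewrite size_conj_part => ih.
  by rewrite !nth_mkseq ?(ltnW ih) //=; apply: colen_anti.
apply/mapP => -[j]; rewrite mem_iota add0n => /andP[_ jh] /esym/eqP.
rewrite -leqn0 leqNgt -has_count => /negP; apply.
by case: nu jh {nuP} => //= a nu ->.
Qed.

(** The index set is brought to that of the Laplace expansion. A non-zero term needs nu inside [la],
    hence at most m parts, and the conjugate of nu inside [mu], hence parts at most p; all other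
    terms have a vanishing factor on either side. *)
Lemma rs_char_box la mu m p : is_part la -> is_part mu ->
  (size la <= m)%N -> (size mu <= p)%N ->
  rs_char la mu = \sum_(nu <- box m p)
    (-1) ^+ sumn nu * skew_schur la nu * skew_schur mu (conj_part nu).
Proof.
move=> laP muP lam mup; rewrite /rs_char.
rewrite (bigID (fun nu => head 0%N nu <= p)%N) /= addrC big1_seq ?add0r; last first.
  move=> nu /andP[]; rewrite -ltnNge => ph.
  rewrite mem_subparts // => /andP[nuP _].
  rewrite {2}/skew_schur ifN ?mulr0 //; apply/negP => /part_inclP/(_ p).
  rewrite [part mu p]part_default // part_conj // leqn0 -leqn0 leqNgt.
  by rewrite -has_count; case: nu ph {nuP} => //= a nu ->.
rewrite [RHS](bigID (part_incl^~ la)) /= [X in _ = _ + X]big1 ?addr0; last first.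
  by move=> nu /negPf nula; rewrite {1}/skew_schur nula mulr0 mul0r.
rewrite -big_filter -[RHS]big_filter; apply/perm_big/uniq_perm.
- by rewrite filter_uniq // subparts_uniq.
- by rewrite filter_uniq // box_uniq.
move=> nu; rewrite !mem_filter mem_box mem_subparts //.
case: (boolP (is_part nu)) => nuP; rewrite /= ?andbF //.
case: (boolP (part_incl nu la)) => [/part_inclP incl|]; rewrite /= ?andbF // !andbT.
suff -> : (size nu <= m)%N by [].
case: (leqP (size nu) m) => // ml.
have := incl m; rewrite [part la m]part_default // leqn0 => /eqP E.
by have := ltn_part_size m nuP; rewrite E ml.
Qed.

(** * Beta sets, cores and quotients *)

Local Open Scope nat_scope.

Lemma gtn_trans : transitive gtn.
Proof. by move=> y x z /= xy yz; apply: ltn_trans yz xy. Qed.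

Lemma geq_trans : transitive geq.
Proof. by move=> y x z /= xy yz; apply: leq_trans yz xy. Qed.

Lemma nth_filter_gt0 (s : seq nat) k : sorted geq s ->
  nth 0 [seq x <- s | 0 < x] k = nth 0 s k.
Proof.
elim: s k => [//|x s IH] k /= xs; case: ltnP => x0.
  by case: k => //= k; apply: IH; apply: path_sorted xs.
move: xs; rewrite (path_sortedE geq_trans) => /andP[/allP xs _].
have s0 y : y \in s -> y = 0 by move/xs => /=; lia.
rewrite (_ : [seq _ <- s | _] = [::]) ?nth_nil; last first.
  by apply/eqP; rewrite -(negbK (_ == _)) -has_filter; apply/hasPn => y /s0 ->.
case: k => [|k] /=; first by lia.
case: (ltnP k (size s)) => ks; last by rewrite nth_default.
by rewrite (s0 (nth 0 s k)) ?mem_nth.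
Qed.

Section PartOfBeta.
Variables (s : seq nat) (sS : sorted gtn s).

Lemma sorted_gtn_nth i j : i < j < size s -> nth 0 s j < nth 0 s i.
Proof.
case/andP => ij js; have := sorted_ltn_nth gtn_trans 0 sS.
by move/(_ i j); rewrite !inE; apply=> //; apply: ltn_trans js.
Qed.

Lemma sorted_gtn_ge k : k < size s -> size s - k.+1 <= nth 0 s k.
Proof.
move=> ks; move E : (size s - k.+1) => d.
elim: d k ks E => [//|d IH] k ks E.
have k1 : k.+1 < size s by lia.
by apply: leq_ltn_trans (IH _ k1 _) (sorted_gtn_nth _); lia.
Qed.

Lemma part_of_beta_pre_sorted :
  sorted geq (mkseq (fun k => nth 0 s k - (size s - k.+1)) (size s)).
Proof.
apply/(sortedP 0) => i; rewrite size_mkseq => i1.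
rewrite !nth_mkseq ?(ltnW i1) //=.
by have := @sorted_gtn_nth i i.+1; rewrite ltnSn i1 => /(_ isT); lia.
Qed.

Lemma part_of_beta_is_part : is_part (part_of_beta s).
Proof.
apply/andP; split; last by rewrite mem_filter ltnn.
by apply: sorted_filter part_of_beta_pre_sorted; exact: geq_trans.
Qed.

Lemma size_part_of_beta : size (part_of_beta s) <= size s.
Proof. by rewrite size_filter (leq_trans (count_size _ _)) ?size_mkseq. Qed.

Lemma nth_part_of_beta k : k < size s ->
  nth 0 s k = part (part_of_beta s) k + (size s - k.+1).
Proof.
move=> ks; rewrite /part nth_filter_gt0 ?part_of_beta_pre_sorted //.
by rewrite nth_mkseq // subnK // sorted_gtn_ge.
Qed.

Lemma beta_part_of_beta : beta_seq (part_of_beta s) (size s) = s.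
Proof.
apply: (@eq_from_nth _ 0) => [|i]; first by rewrite size_mkseq.
by rewrite size_mkseq => i_s; rewrite nth_mkseq // nth_part_of_beta.
Qed.

End PartOfBeta.

Lemma ltn_colen la i j : is_part la -> (i < colen la j) = (j < part la i).
Proof.
elim: la i => [|a la IH] i laP; first by rewrite /part nth_nil.
have [ja|aj] := ltnP j a.
  move: laP; rewrite part_cons => /and3P[_ _ laP].
  by case: i => [|i]; rewrite /colen /= ja // add1n ltnS IH.
rewrite colen_eq0 // ltn0; symmetry; apply/negbTE; rewrite -leqNgt.
by apply: leq_trans aj; exact: part_anti laP (leq0n i).
Qed.

Lemma colen_size la j : colen la j <= size la.
Proof. exact: count_size. Qed.

Lemma ltn_count_iota (p : pred nat) m i :
  (forall k, p k.+1 -> p k) -> (i < count p (iota 0 m)) = (i < m) && p i.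
Proof.
move=> pS; elim: m => [//|m IH].
rewrite -[in iota _ _]addn1 iotaD count_cat /= addn0 add0n.
case: (boolP (p m)) => pm; last first.
  by rewrite addn0 IH ltnS [i <= m]leq_eqVlt; case: eqP => [->|//];
    rewrite ltnn (negPf pm).
have pk k : k <= m -> p k.
  move: pm; elim: m {IH} => [|m IHm] pm; first by rewrite leqn0 => /eqP ->.
  by rewrite leq_eqVlt => /predU1P[->//|]; apply: IHm; apply: pS.
have /eqP-> : count p (iota 0 m) == size (iota 0 m).
  by rewrite -all_count; apply/allP => k; rewrite mem_iota => /andP[_ /ltnW/pk].
rewrite size_iota addn1; case: (ltnP i m.+1) => //= im.
by rewrite pk.
Qed.

Lemma ltn_frob_rank la i : is_part la -> (i < frob_rank la) = (i < part la i).
Proof.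
move=> laP; rewrite ltn_count_iota => [|k kp]; last first.
  by apply: leq_trans (part_anti laP (leqnSn k)); apply: ltnW.
case: (ltnP i (size la)) => //= il; by rewrite part_default.
Qed.

Lemma orthogonal_partP la : is_part la ->
  reflect (forall i, i < part la i -> part la i = (colen la i).+1)
          (orthogonal_part la).
Proof.
move=> laP; apply: (iffP allP) => H i.
  move=> ip; have := H i; rewrite mem_iota ltn_frob_rank // => /(_ ip)/eqP.
  rewrite /leg /arm part_conj //; have := ltn_colen i i laP; rewrite ip; lia.
rewrite mem_iota ltn_frob_rank // => /andP[_ ip]; apply/eqP.
rewrite /leg /arm part_conj //; have := ltn_colen i i laP; rewrite ip (H _ ip); lia.
Qed.

(* The beta numbers at least N are N + arm and the missing numbers below N are
   N - 1 - leg, so that an orthogonal partition is one whose Maya diagram omits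
   N and is mapped, outside N, to its complement by the reflection of centre
   N. *)
Section Maya.
Variables (la : seq nat) (N : nat).
Hypotheses (laP : is_part la) (laN : size la <= N).
Let B := beta_seq la N.

Lemma mem_beta_ge d : reflect (exists i, part la i = i.+1 + d) (N + d \in B).
Proof.
apply: (iffP mapP) => [[i]|[i E]].
  by rewrite mem_iota => /andP[_ iN] E; exists i; lia.
have i_la : i < size la by have := ltn_part_size i laP; rewrite E.
by exists i; rewrite ?mem_iota; lia.
Qed.

Lemma mem_beta_lt d : 0 < d ->
  reflect (exists j, colen la j = j + d) ((d <= N) && (N - d \notin B)).
Proof.
move=> d0; apply: (iffP andP) => [[dN /mapP nB]|[j E]]; last first.
  have dN : d <= N by have := colen_size la j; lia.
  split=> //; apply/mapP => -[i]; rewrite mem_iota => /andP[_ iN] Ei.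
  by have := ltn_colen i j laP; rewrite E; lia.
(* The least such k is the first row whose beta number is at most N - d. As N - d is missing, that
   number is even smaller, so the column k - d has length exactly k. *)
have ex : exists k, part la k + d <= k.+1.
  by exists N; rewrite part_default; lia.
case: (ex_minnP ex) => k kd mink.
have kN : k <= N by apply: mink; rewrite part_default; lia.
have {}kd : part la k + d <= k.
  rewrite leqNgt; apply/negP => kd'; apply: nB; exists k.
    rewrite mem_iota; case: (ltnP k N) => // Nk.
    by rewrite part_default in kd kd'; lia.
  case: (ltnP k N) => // Nk; last by rewrite part_default in kd kd' *; lia.
  by lia.
exists (k - d); rewrite subnK; last by lia.
have := ltn_colen k (k - d) laP; have := ltn_colen k.-1 (k - d) laP.
have := mink k.-1; lia.
Qed.

Lemma orthogonal_maya : orthogonal_part la <->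
  (forall d, (N + d \in B) = [&& 0 < d, d <= N & N - d \notin B]).
Proof.
split=> [/(orthogonal_partP laP) O d|S].
  apply/idP/idP => [/mem_beta_ge[i E]|/andP[d0 /mem_beta_lt[//|j E]]].
    have := O i; rewrite E => /(_ _) Oi.
    have ci := ltn_colen i i laP.
    have d0 : 0 < d by lia.
    by rewrite d0 /=; apply/mem_beta_lt => //; exists i; lia.
  have cj := ltn_colen j j laP; have := O j.
  by move=> Oj; apply/mem_beta_ge; exists j; lia.
pose k := frob_rank la; have rk i := ltn_frob_rank i laP.
have ck i := ltn_colen i i laP.
(* [a] is the arm and [b] the leg plus one. Both strictly decrease along the diagonal, so the
   symmetry, which only equates their sets of values, equates them term by term. *)
pose a i := part la i - i.+1; pose b i := colen la i - i.
have : map a (iota 0 k) = map b (iota 0 k).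
  have sm (g : nat -> nat) : (forall i, i.+1 < k -> g i.+1 < g i) ->
      sorted gtn (map g (iota 0 k)).
    move=> gS; apply/(sortedP 0) => i; rewrite size_map size_iota => ik.
    by rewrite !(nth_map 0) ?size_iota ?(ltnW ik) // !nth_iota ?(ltnW ik) //; apply: gS.
  apply: (irr_sorted_eq gtn_trans ltnn).
  - apply: sm => i ik; have := part_anti laP (leqnSn i); have := rk i.+1.
    by rewrite /a; lia.
  - apply: sm => i ik; have := @colen_anti la _ _ (leqnSn i); have := rk i.+1.
    by have := ck i.+1; rewrite /b; lia.
  move=> d; apply/mapP/mapP => -[i]; rewrite mem_iota => /andP[_ ik] E.
    have : N + d \in B.
      by apply/mem_beta_ge; exists i; have := rk i; rewrite E /a; lia.
    rewrite S => /andP[d0 /mem_beta_lt[//|j Ej]]; exists j; last by rewrite /b; lia.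
    by rewrite mem_iota; have := ck j; have := rk j; lia.
  have d0 : 0 < d by have := ck i; have := rk i; rewrite E /b; lia.
  have : N + d \in B.
    rewrite S d0 /=; apply/mem_beta_lt => //; exists i.
    by have := rk i; have := ck i; rewrite E /b; lia.
  move/mem_beta_ge => [j Ej]; exists j; last by rewrite /a; lia.
  by rewrite mem_iota; have := rk j; lia.
move=> ab; apply/(orthogonal_partP laP) => i ip.
have ik : i < k by rewrite rk.
have := congr1 (fun s => nth 0 s i) ab.
rewrite !(nth_map 0) ?size_iota // !nth_iota // add0n /a /b.
by have := ck i; lia.
Qed.

Lemma frob_rank_beta : frob_rank la = count (leq N) B.
Proof.
rewrite /frob_rank /B /beta_seq /mkseq count_map -(subnKC laN) iotaD count_cat.
rewrite [X in _ = _ + X](_ : _ = 0) ?addn0; last first.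
  apply/eqP; rewrite -leqn0 leqNgt -has_count; apply/hasPn => i.
  by rewrite mem_iota => /andP[il iN] /=; rewrite part_default //; lia.
apply: eq_in_count => i; rewrite mem_iota => /andP[_ iS] /=.
by move: laN; lia.
Qed.
End Maya.

Lemma sum_count_mod t s : 0 < t ->
  \sum_(0 <= r < t) count (fun x => x %% t == r) s = size s.
Proof.
move=> t0; rewrite big_mkord; elim: s => [|x s IH]; first by rewrite big1.
rewrite /= big_split IH /= (bigD1 (Ordinal (ltn_pmod x t0))) //= eqxx.
rewrite big1 ?addn0 ?add1n // => r /eqP rx.
by case: eqP => // E; case: rx; apply: val_inj.
Qed.

(** * The core through its runners, and the criterion for it to be orthogonal *)

Section Core.
Variables (t n : nat) (la : seq nat).
Hypotheses (t0 : 0 < t) (laP : is_part la).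
Let N := n * t.
Local Notation m := (nb_res t la N).
Let c := tcore t la N.
Let pre := [seq k * t + r | r <- iota 0 t, k <- iota 0 (m r)].

Lemma mem_core_runners k r : r < t -> (k * t + r \in pre) = (k < m r).
Proof.
move=> rt; apply/allpairsPdep/idP => [[r' [k' [+ + E]]]|km].
  rewrite !mem_iota !add0n => r't k'm.
  have Er : r = r'.
    by have := congr1 (modn^~ t) E; rewrite !modnMDl !modn_small.
  have Ek : k = k'.
    by have := congr1 (divn^~ t) E; rewrite !divnMDl // !divn_small // !addn0.
  by rewrite Er Ek.
by exists r, k; rewrite !mem_iota.
Qed.

Lemma core_runners_uniq : uniq pre.
Proof.
apply: allpairs_uniq_dep => [|r _|]; [exact: iota_uniq..|].
move=> [r k] [r' k'] /allpairsPdep[x [y [+ _ [E1 E2]]]]; subst x y.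
rewrite mem_iota => rt /allpairsPdep[x [y [+ _ [E1 E2]]]]; subst x y.
rewrite mem_iota => r't /= E.
have Er : r = r'.
  by have := congr1 (modn^~ t) E; rewrite !modnMDl !modn_small.
have Ek : k = k'.
  by have := congr1 (divn^~ t) E; rewrite !divnMDl // !divn_small // !addn0.
by rewrite Er Ek.
Qed.

Lemma size_core_runners : size pre = N.
Proof.
rewrite size_allpairs_dep sumnE big_map.
under eq_bigr do rewrite size_iota.
have := sum_count_mod (beta_seq la N) t0; rewrite size_mkseq => E.
by rewrite -[RHS]E /index_iota subn0.
Qed.

Lemma beta_tcore : beta_seq c N = sort geq pre.
Proof.
have E : size (sort geq pre) = N by rewrite size_sort size_core_runners.
rewrite -[in LHS]E beta_part_of_beta //.
rewrite gtn_sorted_uniq_geq sort_uniq core_runners_uniq.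
by apply: sort_sorted => x y; exact: leq_total.
Qed.

Lemma tcore_is_part : is_part c.
Proof.
apply: part_of_beta_is_part; rewrite gtn_sorted_uniq_geq sort_uniq.
rewrite core_runners_uniq; by apply: sort_sorted => x y; exact: leq_total.
Qed.

Lemma size_tcore : size c <= N.
Proof.
have := size_part_of_beta (sort geq pre).
by rewrite size_sort size_core_runners.
Qed.

Lemma mem_beta_tcore k r : r < t -> (k * t + r \in beta_seq c N) = (k < m r).
Proof. by move=> rt; rewrite beta_tcore mem_sort mem_core_runners. Qed.

Lemma frob_rank_tcore : frob_rank c = \sum_(0 <= r < t) (m r - n).
Proof.
rewrite (frob_rank_beta tcore_is_part size_tcore) beta_tcore.
have /seq.permP-> : perm_eq (sort geq pre) pre by rewrite perm_sort.
rewrite /pre count_flatten sumnE !big_map /index_iota subn0.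
rewrite big_seq [RHS]big_seq; apply: eq_bigr => r; rewrite mem_iota => rt.
rewrite count_map (eq_count (a2 := leq n)); last first.
  by move=> k /=; apply/idP/idP; nia.
elim: (m r) => [//|k IH].
by rewrite -[in iota _ _]addn1 iotaD count_cat IH /= addn0 add0n; lia.
Qed.

(** Runner r of the core is occupied exactly below height m_r. The reflection about N = nt sends
    height n + k on runner r > 0 to height n - k - 1 on runner t - r, and preserves runner 0, where
    N itself must be free. Exchanging occupied and empty places then amounts to the stated
    equalities. *)
Lemma orthogonal_tcore : orthogonal_part c <->
  m 0 = n /\ forall r, 0 < r < t -> m r + m (t - r) = n.*2.
Proof.
rewrite (orthogonal_maya tcore_is_part size_tcore).
have memB := mem_beta_tcore; move: (nb_res t la N) memB => M memB; split=> [S|[m0 mr] d].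
  have Sk k r d : r < t -> d = k * t + r -> (N + d \in beta_seq c N) = (n + k < M r).
    by move=> rt ->; rewrite addnA -mulnDl memB.
  split.
    have := S 0; rewrite (Sk 0 0) // addn0 /= => m0n.
    case: (ltngtP (M 0) n) => // mn; last by lia.
    have dE : (n - M 0) * t = (n - M 0) * t + 0 by rewrite addn0.
    have := S ((n - M 0) * t); rewrite (Sk _ _ _ t0 dE).
    have -> : N - (n - M 0) * t = M 0 * t + 0 by rewrite /N addn0; nia.
    by rewrite memB // ltnn; have : (n - M 0) * t <= N; rewrite /N; nia.
  (* The first bound tests the symmetry at the last occupied place of runner r, the second at the
     first empty place of runner t - r. Used for both r and t - r, they force equality. *)
  suff H r : 0 < r < t -> (n < M r -> M r + M (t - r) <= n.*2) /\
      (M (t - r) < n -> n.*2 <= M r + M (t - r)).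
    move=> r rt; have [H1 H2] := H r rt.
    have [H3 H4] := H (t - r) ltac:(lia); rewrite subKn in H3 H4; lia.
  move=> rt; have r_t : r < t by lia. have r't : t - r < t by lia.
  split=> H.
    have := S ((M r - n.+1) * t + r); rewrite (Sk _ _ _ r_t erefl).
    have -> : n + (M r - n.+1) < M r by lia.
    move=> /esym/and3P[_ dN].
    have mn : M r <= n.*2.
      by rewrite /N in dN; rewrite leqNgt; apply/negP => C; nia.
    have -> : N - ((M r - n.+1) * t + r) = (n.*2 - M r) * t + (t - r).
      by rewrite /N in dN *; nia.
    by rewrite memB //; lia.
  have := S ((n - (M (t - r)).+1) * t + r); rewrite (Sk _ _ _ r_t erefl).
  have -> : N - ((n - (M (t - r)).+1) * t + r) = M (t - r) * t + (t - r).
    by rewrite /N; nia.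
  rewrite memB // ltnn.
  have -> : 0 < (n - (M (t - r)).+1) * t + r by nia.
  have -> : (n - (M (t - r)).+1) * t + r <= N by rewrite /N; nia.
  by move=> /= ?; lia.
have rt := ltn_pmod d t0; have dE := divn_eq d t.
move: (d %/ t) (d %% t) rt dE => q r rt ->.
rewrite addnA -mulnDl memB //.
case: (posnP r) => [->|r0].
  rewrite m0 addn0; apply: esym; apply/idP/idP; last by lia.
  case/and3P => q0 qN.
  have -> : N - q * t = (n - q) * t + 0 by rewrite addn0 /N -mulnBl.
  by rewrite memB // m0; nia.
have := mr r; rewrite r0 rt => /(_ isT) E.
apply/idP/idP => [H|/and3P[_ dN]].
  have -> : N - (q * t + r) = (n - q.+1) * t + (t - r) by rewrite /N; nia.
  by rewrite memB; rewrite /N; nia.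
have qn : q < n.
  by rewrite /N in dN; rewrite ltnNge; apply/negP => C; nia.
have -> : N - (q * t + r) = (n - q.+1) * t + (t - r).
  by rewrite /N in dN *; nia.
rewrite memB; last by lia.
by rewrite /N in dN; nia.
Qed.
End Core.

(** * The beta set sorted by residues, and the quotient *)

Section Runners.
Variables (t : nat) (la : seq nat) (N : nat).
Hypotheses (t0 : 0 < t) (laP : is_part la).
Local Notation m := (nb_res t la N).
Local Notation q := (tquot t la N).

Definition runner (r : nat) : seq nat := [seq x <- beta_seq la N | x %% t == r].
Definition runners : seq nat := flatten [seq runner r | r <- iota 0 t].

Lemma size_runner r : size (runner r) = m r.
Proof. exact: size_filter. Qed.

Lemma mem_runner r x : x \in runner r -> x %% t = r.
Proof. by rewrite mem_filter => /andP[/eqP]. Qed.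

Lemma runner_sorted r : sorted gtn (runner r).
Proof. by apply: sorted_filter (beta_seq_sorted _ laP); exact: gtn_trans. Qed.

Lemma runner_div_sorted r : sorted gtn [seq x %/ t | x <- runner r].
Proof.
apply/(sortedP 0) => i; rewrite size_map => i1.
rewrite !(nth_map 0) ?(ltnW i1) //=.
have := sorted_gtn_nth (runner_sorted r) (i := i) (j := i.+1).
rewrite ltnSn i1 => /(_ isT); set x := nth 0 _ _; set y := nth 0 _ _ => xy.
have xr : x %% t = r by apply/mem_runner/mem_nth.
have yr : y %% t = r by apply/mem_runner/mem_nth/ltnW.
by rewrite (divn_eq x t) (divn_eq y t) xr yr in xy; nia.
Qed.

Lemma tquot_is_part r : is_part (q r).
Proof. exact/part_of_beta_is_part/runner_div_sorted. Qed.

Lemma size_tquot r : size (q r) <= m r.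
Proof.
have := size_part_of_beta [seq x %/ t | x <- runner r].
by rewrite size_map size_runner.
Qed.

Lemma runnerE r :
  runner r = mkseq (fun k => (part (q r) k + (m r - k.+1)) * t + r) (m r).
Proof.
apply: (@eq_from_nth _ 0) => [|k]; first by rewrite size_mkseq size_runner.
move=> ks; rewrite nth_mkseq -?size_runner //.
have kr : nth 0 (runner r) k %% t = r by apply/mem_runner/mem_nth.
have := nth_part_of_beta (runner_div_sorted r) (k := k).
rewrite size_map (nth_map 0) // => /(_ ks) <-.
by rewrite [LHS](divn_eq _ t) kr.
Qed.

Lemma mem_runners x : (x \in runners) = (x \in beta_seq la N).
Proof.
apply/flatten_mapP/idP => [[r _]|xb]; first by rewrite mem_filter => /andP[].
by exists (x %% t); rewrite ?mem_iota ?ltn_pmod // mem_filter eqxx.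
Qed.

Lemma runners_sorted : sorted (res_lt t) runners.
Proof.
rewrite sorted_pairwise; last exact: res_lt_trans.
rewrite /runners; elim: (iota 0 t) (iota_ltn_sorted 0 t) => [//|r l IH] /= rl.
rewrite pairwise_cat IH ?(path_sorted rl) // andbT; apply/andP; split.
  apply/allrelP => x y /mem_runner xr /flatten_mapP[r' r'l /mem_runner yr].
  move: rl; rewrite (path_sortedE ltn_trans) => /andP[/allP/(_ _ r'l) /= rr' _].
  by rewrite /res_lt xr yr rr'.
rewrite -sorted_pairwise; last exact: res_lt_trans.
apply/(sortedP 0) => i i1.
have xr : nth 0 (runner r) i %% t = r by apply/mem_runner/mem_nth/ltnW.
have yr : nth 0 (runner r) i.+1 %% t = r by apply/mem_runner/mem_nth.
rewrite /res_lt xr yr ltnn eqxx /=.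
by apply: (sorted_gtn_nth (runner_sorted r)); rewrite ltnSn.
Qed.

Lemma runners_wt :
  runners = [seq nth 0 (beta_seq la N) (wt t la N i) | i <- enum 'I_N].
Proof.
have irr : irreflexive (res_lt t) by move=> x; exact: res_ltxx.
apply: (irr_sorted_eq (@res_lt_trans t) irr runners_sorted) => [|x].
  rewrite sorted_map sorted_pairwise; last first.
    by move=> y x z; exact: res_lt_trans.
  have : pairwise (fun i j : 'I_N => (i < j)%N) (enum 'I_N).
    by rewrite -(pairwise_map val ltn) val_enum_ord -sorted_pairwise
       ?iota_ltn_sorted //; exact: ltn_trans.
  apply: sub_pairwise => i j ij.
  have /forallP/(_ i)/forallP/(_ j)/implyP := rearranges_exists t N laP.
  exact.
rewrite mem_runners; apply/idP/mapP => [xb|[i _ ->]]; last first.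
  by rewrite mem_nth // size_mkseq.
have xN : index x (beta_seq la N) < N by rewrite -index_mem size_mkseq in xb.
exists ((wt t la N)^-1%g (Ordinal xN)); first by rewrite mem_enum.
by rewrite permKV /= nth_index.
Qed.

Lemma sdet_beta_runners (R : comNzRingType) (f : nat -> nat -> R) :
  sdet f (beta_seq la N) (iota 1 N) =
  ((-1) ^+ wt t la N * sdet f runners (iota 1 N))%R.
Proof.
have -> : iota 1 N = mkseq succn N by rewrite (iotaDl 1 0).
have sz : size runners = N by rewrite runners_wt size_map size_enum_ord.
rewrite -[runners](mkseq_nth 0) sz !sdet_mkseq.
set M := (M in \det M = _); set w := wt t la N.
suff -> : (\matrix_(i, j) f (nth 0 runners i) j.+1 = row_perm w M)%R.
  by rewrite row_permE det_mulmx det_perm mulrA -expr2 sqrr_sign mul1r.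
apply/matrixP => i j; rewrite !mxE runners_wt.
rewrite (nth_map i) ?size_enum_ord // nth_ord_enum.
by rewrite nth_mkseq.
Qed.
End Runners.

(** * Counting inversions in concatenated and periodic lists *)

Lemma invs_cat T (P : pred T) s1 s2 : invs P (s1 ++ s2) =
  invs P s1 + invs P s2 + count (predC P) s1 * count P s2.
Proof.
elim: s1 => [|x s1 IH] /=; first by rewrite mul0n addn0.
by rewrite IH count_cat; case: (P x) => /=; lia.
Qed.

Lemma invs_all T (P : pred T) s : all P s -> invs P s = 0.
Proof. by elim: s => //= x s IH /andP[-> /IH->]. Qed.

Lemma invs_none T (P : pred T) s : all (predC P) s -> invs P s = 0.
Proof.
elim: s => //= x s IH /andP[/negPf -> Ps]; rewrite IH // addn0.
by apply/eqP; rewrite -leqn0 leqNgt -has_count -all_predC.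
Qed.

Lemma count_all T (P : pred T) s : all P s -> count P s = size s.
Proof. by rewrite all_count => /eqP. Qed.

Lemma count_none T (P : pred T) s : all (predC P) s -> count P s = 0.
Proof. by move/count_all => E; have := count_predC P s; lia. Qed.

Lemma filter_none T (P : pred T) s : all (predC P) s -> filter P s = [::].
Proof. by elim: s => //= x s IH /andP[/negPf ->]. Qed.

(** Each period has e inversions of its own; each of the C(n,2) pairs of periods adds l r, from the
    l failing entries of the earlier one and the r satisfying entries of the later one. *)
Lemma invs_periodic T (P : pred T) (per : nat -> seq T) e l r n :
  (forall k, [/\ invs P (per k) = e, count (predC P) (per k) = l
               & count P (per k) = r]) ->
  invs P (flatten [seq per k | k <- iota 0 n]) = n * e + 'C(n, 2) * (l * r).
Proof.
move=> perE.
have cl k : count (predC P) (flatten [seq per k | k <- iota 0 k]) = k * l.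
  elim: k => [//|k IH]; rewrite -[in iota _ _]addn1 iotaD map_cat flatten_cat.
  by rewrite count_cat IH /= cats0; case: (perE (0 + k)) => _ -> _; lia.
elim: n => [//|n IH]; rewrite -[in iota _ _]addn1 iotaD map_cat flatten_cat.
rewrite invs_cat IH cl /= cats0; case: (perE (0 + n)) => -> _ ->.
by rewrite binS bin1; lia.
Qed.

Local Open Scope ring_scope.

(** * Factorisation *)

Section Factorisation.
Variables (t n : nat) (la : seq nat) (phi : {rmorphism symfun -> symfun}).
Hypotheses (t2 : (2 <= t)%N) (laP : is_part la).
Hypothesis phiE : forall r : nat,
  phi (hsym r) = if (t %| r)%N then hsym (r %/ t) else 0.
Let N := (n * t)%N.
Local Notation m := (nb_res t la N).
Local Notation q := (tquot t la N).
Local Notation run := (runner t la N).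
Let t0 : (0 < t)%N := ltnW t2.

Definition o_entry (x c : nat) : symfun :=
  phi (hsymz (x%:Z - N%:Z + c%:Z)) - phi (hsymz (x%:Z - N%:Z - c%:Z)).

Lemma phi_hsymz_mul k : phi (hsymz (k * t%:Z)) = hsymz k.
Proof.
case: k => r; last by rewrite !hsymz_lt0 ?rmorph0 //; nia.
by rewrite -PoszM [LHS]phiE dvdn_mull // mulnK.
Qed.

Lemma phi_hsymz_ndvd k : (forall j, k <> j * t%:Z) -> phi (hsymz k) = 0.
Proof.
case: k => r kt; last by rewrite hsymz_lt0 ?rmorph0.
rewrite [LHS]phiE; case: dvdnP => // -[j E].
by case: (kt j%:Z); rewrite E PoszM.
Qed.

Lemma phi_hsymz_rem k b : (0 < b < t)%N -> phi (hsymz (k * t%:Z + b%:Z)) = 0.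
Proof.
move=> bt; apply: phi_hsymz_ndvd => j jE.
have : b%:Z = (j - k) * t%:Z by lia.
have [jk|jk] : j - k <= 0 \/ 1 <= j - k by lia.
  by nia.
by nia.
Qed.

Lemma o_entry_supp x c : o_entry x c != 0 ->
  (x %% t = c %% t \/ x %% t + c %% t = t)%N.
Proof.
have := divn_eq x t; have := divn_eq c t.
have := ltn_pmod x t0; have := ltn_pmod c t0.
move: (x %% t)%N (c %% t)%N (x %/ t)%N (c %/ t)%N => rx rc qx qc rct rxt cE xE.
move=> nz; suff /orP[/eqP|/eqP] : (rx == rc) || (rx + rc == t)%N.
- by left.
- by right.
apply: contraNT nz; rewrite negb_or => /andP[rxc rxct]; rewrite /o_entry.
rewrite !phi_hsymz_ndvd ?subr0 //.
  move=> j; rewrite cE xE /N => E; case/eqP: rxc.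
  have {}E : rx%:Z - rc%:Z = (j + n%:Z - qx%:Z + qc%:Z) * t%:Z by lia.
  move: (j + _ - _ + _) E => J E.
  have [z|[z|z]] : J <= -1 \/ J = 0 \/ 1 <= J by lia.
  - by nia.
  - by rewrite z mul0r in E; lia.
  by nia.
move=> j; rewrite cE xE /N => E.
have {}E : rx%:Z + rc%:Z = (j + n%:Z - qx%:Z - qc%:Z) * t%:Z by lia.
move: (j + _ - _ - _) E => J E.
have [z|[z|[z|z]]] : J <= -1 \/ J = 0 \/ J = 1 \/ 2 <= J by lia.
- by nia.
- by rewrite z mul0r in E; case/eqP: rxc; lia.
- by rewrite z mul1r in E; case/eqP: rxct; lia.
by nia.
Qed.

Lemma runner_row p k l r : (k < l)%N ->
  ((p + (l - k.+1)) * t + r)%N%:Z =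
  (p%:Z - k.+1%:Z + l%:Z) * t%:Z + r%:Z.
Proof. by move=> kl; rewrite !(PoszD, PoszM) -subzn //; ring. Qed.

Lemma block_zero : m 0 = n ->
  sdet o_entry (run 0) (mkseq (fun j => j.+1 * t)%N n) = o_char (q 0).
Proof.
move=> m0; have q0 := size_tquot t la N 0.
rewrite (o_char_det (m := n)) -?[n in leqRHS]m0 ?tquot_is_part //.
rewrite runnerE // m0 sdet_mkseq; congr (\det _).
apply/matrixP => i j; rewrite !mxE /o_entry runner_row // /N.
congr (_ - _); rewrite -[RHS]phi_hsymz_mul; congr (phi (hsymz _));
  by rewrite !PoszM; ring.
Qed.

(** The residues h of the row and of the column add up to a full t in the first term of the entry
    and cancel in the second: this is the extra 1 in the index that distinguishes so^- from o. *)
Lemma block_half h : t = h.*2 -> m h = n ->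
  sdet o_entry (run h) (mkseq (fun j => j * t + h)%N n) = som_char (q h).
Proof.
move=> th mh; have qh := size_tquot t la N h.
rewrite (som_char_det (m := n)) -?[n in leqRHS]mh ?tquot_is_part //.
rewrite runnerE // mh sdet_mkseq; congr (\det _).
apply/matrixP => i j; rewrite !mxE /o_entry runner_row // /N.
have t_h : t%:Z = h%:Z + h%:Z by lia.
congr (_ - _); rewrite -[RHS]phi_hsymz_mul; congr (phi (hsymz _));
  by rewrite !(PoszD, PoszM) t_h; ring.
Qed.

Definition pair_cols a : seq nat :=
  flatten [seq [:: k * t + a; k * t + (t - a)]%N | k <- iota 0 n].

(* The d-th column congruent to - a modulo t for d > 0, and the (1 - d)-th
   column congruent to a for d <= 0: with this indexing the shift of h in the
   entries of the block is linear in d. *)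
Let col a (d : int) : nat :=
  if 0 < d then (`|d|.-1 * t + (t - a))%N else (`|d| * t + a)%N.

Lemma pair_colsE a : pair_cols a = map (col a) (zigzag n).
Proof.
rewrite /zigzag map_flatten -map_comp; congr flatten; apply: eq_map => k /=.
rewrite /col (_ : (0 < - k%:Z) = false); last by lia.
by rewrite abszN.
Qed.

(** Once this sign is taken out of column d, the sign of the entry depends on its row only: plus for
    the residue a, minus for t - a. *)
Let sgc (d : int) : symfun := if 0 < d then 1 else -1.

Lemma prod_sgc k : \prod_(d <- zigzag k) sgc d = (-1) ^+ k.
Proof.
elim: k => [|k IH]; first by rewrite big_nil.
rewrite zigzagS big_cat IH /= big_cons big_seq1 /sgc.
rewrite (_ : (0 < - k%:Z) = false) /=; last by lia.
by rewrite mulr1 exprSr.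
Qed.

Let X (x : nat) : int := (x %/ t)%N%:Z - n%:Z.

Lemma colE a d : (a < t)%N ->
  (col a d)%:Z = if 0 < d then d * t%:Z - a%:Z else a%:Z - d * t%:Z.
Proof.
move=> at1; rewrite /col; case: ifP => d0.
  have -> : t%:Z = (t - a)%N%:Z + a%:Z by lia.
  move: d0; case: d => [[|d]|d] // _; rewrite /= !(PoszD, PoszM).
  have -> : t%:Z = (t - a)%N%:Z + a%:Z by lia.
  by rewrite -[d.+1]addn1 PoszD; ring.
have -> : d = - `|d|%N%:Z by lia.
by rewrite abszN absz_nat !(PoszD, PoszM); ring.
Qed.

(** As 0 < 2a < t, exactly one of x + c and x - c is divisible by t for these rows and columns, the
    other being congruent to 2a or - 2a; a single term of the entry survives. *)
Lemma o_entry_pair a x d : (0 < a)%N -> (a.*2 < t)%N ->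
  (x %% t == a)%N || (x %% t == t - a)%N ->
  o_entry x (col a d) = sgc d *
    (if (x %% t == a)%N then hsymz (X x + d) else - hsymz (X x + 1 - d)).
Proof.
move=> a0 at2 xa; have at1 : (a < t)%N by lia.
rewrite /o_entry colE // /sgc.
have -> : x%:Z = (X x + n%:Z) * t%:Z + (x %% t)%N%:Z.
  by rewrite /X subrK -PoszM -PoszD -divn_eq.
move: (X x) => Y; rewrite /N PoszM.
have t_a : (t - a)%N%:Z = t%:Z - a%:Z by lia.
have a2 : (0 < a.*2 < t)%N by lia.
have ta2 : (0 < t - a.*2 < t)%N by lia.
have t_a2 : (t - a.*2)%N%:Z = t%:Z - 2 * a%:Z by lia.
have aa : a.*2%:Z = 2 * a%:Z by lia.
have phi0 k l b : (0 < b < t)%N -> l = k * t%:Z + b%:Z -> phi (hsymz l) = 0.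
  by move=> bt ->; exact: phi_hsymz_rem.
have phi1 k l : l = k * t%:Z -> phi (hsymz l) = hsymz k.
  by move=> ->; exact: phi_hsymz_mul.
case: eqP xa => [-> _|_ /= /eqP ->]; case: ifP => d0.
- rewrite (phi1 (Y + d)); last by ring.
  by rewrite (phi0 (Y - d) _ a.*2) ?subr0 ?mul1r // aa; ring.
- rewrite (phi0 (Y - d) _ a.*2) //; last by rewrite aa; ring.
  by rewrite (phi1 (Y + d)) ?sub0r ?mulN1r //; ring.
- rewrite (phi0 (Y + d) _ (t - a.*2)%N) //; last by rewrite t_a t_a2; ring.
  by rewrite (phi1 (Y + 1 - d)) ?sub0r ?mul1r // t_a; ring.
rewrite (phi1 (Y + 1 - d)); last by rewrite t_a; ring.
rewrite (phi0 (Y + d) _ (t - a.*2)%N) ?subr0 ?mulN1r ?opprK //.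
by rewrite t_a t_a2; ring.
Qed.

Lemma boxcolsC_rev x0 p nu : boxcolsC x0 p nu =
  rev (mkseq (fun l => x0 + (p - l.+1)%N%:Z + (colen nu l)%:Z) p).
Proof.
apply: (@eq_from_nth _ 0) => [|l]; rewrite size_mkseq ?size_rev ?size_mkseq //.
move=> lp; rewrite nth_rev ?size_mkseq // !nth_mkseq //; last by lia.
by have -> : (p - (p - l.+1).+1 = l)%N by lia.
Qed.

Lemma runner_div a k : (a < t)%N -> (k < m a)%N ->
  (((part (q a) k + (m a - k.+1)) * t + a) %/ t)%N%:Z =
  (part (q a) k)%:Z - k.+1%:Z + (m a)%:Z.
Proof. by move=> at1 km; rewrite divnMDl // divn_small // addn0; lia. Qed.

(** The column signs give (-1)^n. The Laplace sign of m_a m_(t-a) and the m_(t-a) negated rows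
    cancel, since m_a and m_(t-a) have the same parity. In the second minor the index decreases with
    d, so its columns are reversed to reach the Jacobi-Trudi matrix of the conjugate partition, at
    the cost of C(m_(t-a),2). *)
Lemma block_pair a : (0 < a)%N -> (a.*2 < t)%N -> (m a + m (t - a) = n.*2)%N ->
  sdet o_entry (run a ++ run (t - a)) (pair_cols a) =
  (-1) ^+ (n + 'C(m (t - a), 2)) * rs_char (q a) (q (t - a)).
Proof.
move=> a0 at2 maa; have at1 : (a < t)%N by lia.
have t_at : (t - a < t)%N by lia.
rewrite pair_colsE sdet_map_col.
pose g x d := if (x %% t == a)%N then hsymz (X x + d) else - hsymz (X x + 1 - d).
rewrite (@eq_in_sdet _ _ _ (fun x d => sgc d * g x d)); last first.
  move=> x d + _; rewrite mem_cat => xr; apply: o_entry_pair => //.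
  by case/orP: xr => /mem_runner ->; rewrite eqxx ?orbT.
rewrite sdet_scale_col prod_sgc -[zigzag n]cats0 sdet_zigzag cats0.
have sa : size (run a) = m a := size_runner _ _ _ _.
have sta : size (run (t - a)) = m (t - a) := size_runner _ _ _ _.
rewrite -maa -{1}sa -{1}sta sdet_laplace sa sta.
rewrite (@rs_char_box _ _ (m a) (m (t - a))) ?tquot_is_part ?size_tquot //.
rewrite !mulr_sumr big_seq [RHS]big_seq; apply: eq_bigr => nu.
rewrite mem_box => /and3P[nuP num nup].
have -> : sdet g (run a) (boxcols (1 - n%:Z) (m a) (m (t - a)) nu)
    = skew_schur (q a) nu.
  rewrite (skew_schur_det (m := m a)) ?tquot_is_part ?size_tquot //.
  rewrite (@eq_in_sdet _ _ _ (fun x d => hsymz (X x + d))); last first.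
    by move=> x d /mem_runner xr _; rewrite /g xr eqxx.
  rewrite runnerE // sdet_mkseq; congr (\det _); apply/matrixP => i j.
  by rewrite !mxE /X runner_div //; congr hsymz; lia.
have -> : sdet g (run (t - a)) (boxcolsC (1 - n%:Z) (m (t - a)) nu)
    = (-1) ^+ (m (t - a) + 'C(m (t - a), 2))
      * skew_schur (q (t - a)) (conj_part nu).
  rewrite (skew_schur_det (m := m (t - a))) ?tquot_is_part ?size_tquot //;
    [|exact: conj_part_is_part|by rewrite size_conj_part].
  rewrite (@eq_in_sdet _ _ _ (fun x d => -1 * hsymz (X x + 1 - d))); last first.
    move=> x d /mem_runner xr _; rewrite /g xr mulN1r ifF //.
    by apply/eqP; lia.
  rewrite (sdet_scale_col (fun=> -1)) big_const_seq count_predT size_mkseq.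
  rewrite iter_mulr_1 boxcolsC_rev sdet_rev size_mkseq exprD -mulrA.
  congr (_ * (_ * _)).
  rewrite runnerE // sdet_mkseq; congr (\det _); apply/matrixP => i j.
  rewrite !mxE /X runner_div // part_conj //; congr hsymz.
  by have := ltn_ord j; lia.
move: (skew_schur _ _) (skew_schur _ _) => A B; rewrite !exprD.
set e := (-1) ^+ m (t - a).
have ee : e * e = 1 by rewrite -expr2 sqrr_sign.
have -> : (-1) ^+ (m a * m (t - a)) = e.
  rewrite /e -signr_odd -[RHS]signr_odd oddM.
  have := congr1 odd maa; rewrite oddD odd_double.
  by case: (odd (m a)); case: (odd (m (t - a))).
transitivity ((e * e) * ((-1) ^+ n * (-1) ^+ 'C(m (t - a), 2)
   * ((-1) ^+ sumn nu * A * B))); last by rewrite ee; ring.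
by ring.
Qed.

(** * Splitting off the residue 0, then the pairs of residues from the outside inwards *)

Definition strip a : seq nat :=
  flatten [seq run r | r <- iota a (t + 1 - a.*2)].
Definition strip_cols a : seq nat := flatten
  [seq [seq (k * t + i)%N | i <- iota a (t + 1 - a.*2)] | k <- iota 0 n].

Lemma size_strip_cols a : size (strip_cols a) = (n * (t + 1 - a.*2))%N.
Proof.
rewrite size_flatten /shape -map_comp sumnE big_map.
under eq_bigr do rewrite /= size_map size_iota.
by rewrite big_const_seq count_predT size_iota iter_addn_0 mulnC.
Qed.

Lemma modn_col k i : (i < t)%N -> ((k * t + i) %% t = i)%N.
Proof. by move=> it; rewrite modnMDl modn_small. Qed.

(** The rows of residue 0 already come first. The k-th multiple of t has k(t - 1) other columns
    before it, and the sum over k <= n is the exponent. *)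
Lemma peel_zero :
  sdet o_entry (runners t la N) (iota 1 N) = (-1) ^+ (t.-1 * 'C(n.+1, 2))
  * sdet o_entry (run 0) (mkseq (fun j => j.+1 * t)%N n)
  * sdet o_entry (strip 1) (strip_cols 1).
Proof.
pose P x := (x %% t == 0)%N.
have t1 : (t = t.-1 + 1)%N by lia.
have st : (t + 1 - 1.*2 = t.-1)%N by lia.
have rowsE : runners t la N = run 0 ++ strip 1.
  by rewrite /runners /strip st -(prednK t0).
pose mid k := [seq (k * t + i)%N | i <- iota 1 t.-1].
pose per k := mid k ++ [:: k.+1 * t]%N.
have colsE : iota 1 N = flatten [seq per k | k <- iota 0 n].
  rewrite /N; elim: n => [|k IH]; first by rewrite mul0n.
  rewrite mulSn addnC iotaD IH -[in RHS]addn1 iotaD map_cat flatten_cat.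
  congr (_ ++ _); rewrite /= cats0 /per /mid {2}t1 iotaD addnC iotaDl.
  by rewrite add0n; congr (_ ++ [:: _]); lia.
have run0 : all P (run 0) by apply/allP => x /mem_runner xr; rewrite /P xr.
have strip0 : all (predC P) (strip 1).
  apply/allP => x /flatten_mapP[r]; rewrite mem_iota st => r1 /mem_runner xr.
  by rewrite /= /P xr; lia.
have mid0 k : all (predC P) (mid k).
  apply/allP => x /mapP[i]; rewrite mem_iota => i1 ->.
  by rewrite /= /P modn_col; lia.
have end0 k : P (k.+1 * t)%N by rewrite /P modnMl.
rewrite (@sdet_split _ _ _ P P); last first.
  move=> x c; apply: contraNeq => /o_entry_supp; rewrite /P.
  by have := ltn_pmod x t0; have := ltn_pmod c t0; lia.
rewrite rowsE !filter_cat (all_filterP run0) (filter_none strip0) cats0.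
rewrite (all_filterP strip0) (filter_none (s := run 0)) ?cat0s; last first.
  by apply: sub_all run0 => x /= ->.
rewrite invs_cat (invs_all run0) (invs_none strip0) (count_none strip0) muln0.
rewrite colsE (@invs_periodic _ _ _ t.-1 t.-1 1); last first.
  move=> k; rewrite /per invs_cat !count_cat (invs_none (mid0 k)).
  rewrite (count_none (mid0 k)) (count_all (mid0 k)) /= end0 size_map size_iota.
  by split; lia.
rewrite !filter_flatten -!map_comp; congr (_ * sdet o_entry (run 0) _ * sdet o_entry (strip 1) _).
- by congr (_ ^+ _); rewrite binS bin1; lia.
- rewrite -[RHS]flatten_seq1 /mkseq -map_comp; congr flatten; apply: eq_map => k.
  by rewrite /= filter_cat (filter_none (mid0 k)) /= end0.
rewrite /strip_cols st; congr flatten; apply: eq_map => k.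
by rewrite /= filter_cat (all_filterP (mid0 k)) /= end0 cats0.
Qed.

(** The rows of residue t - a pass all the remaining rows, nL in number if the remaining block is
    square; if it is not, both sides are 0. The columns contribute nL up to an even number, and L
    has the parity of t - 1. *)
Lemma peel_pair a : (0 < a)%N -> (a.*2 < t)%N ->
  sdet o_entry (strip a) (strip_cols a) =
  (-1) ^+ (n * t.-1 * (m (t - a)).+1)
  * sdet o_entry (run a ++ run (t - a)) (pair_cols a)
  * sdet o_entry (strip a.+1) (strip_cols a.+1).
Proof.
move=> a0 at2; pose P x := (x %% t == a)%N || (x %% t == t - a)%N.
pose L := (t + 1 - a.+1.*2)%N.
have iotaE : iota a (t + 1 - a.*2) = a :: iota a.+1 L ++ [:: t - a]%N.
  rewrite (_ : t + 1 - a.*2 = (L + 1).+1)%N; last by rewrite /L; lia.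
  by rewrite /= iotaD /=; congr (_ :: _ ++ [:: _]); rewrite /L; lia.
have rowsE : strip a = run a ++ strip a.+1 ++ run (t - a).
  by rewrite /strip iotaE /= map_cat flatten_cat /= cats0.
pose mid k := [seq (k * t + i)%N | i <- iota a.+1 L].
pose per k := (k * t + a)%N :: mid k ++ [:: k * t + (t - a)]%N.
have colsE : strip_cols a = flatten [seq per k | k <- iota 0 n].
  rewrite /strip_cols; congr flatten; apply: eq_map => k.
  by rewrite iotaE /= map_cat.
have run1 : all P (run a).
  by apply/allP => x /mem_runner xr; rewrite /P xr eqxx.
have run2 : all P (run (t - a)).
  by apply/allP => x /mem_runner xr; rewrite /P xr eqxx orbT.
have strip0 : all (predC P) (strip a.+1).
  apply/allP => x /flatten_mapP[r]; rewrite mem_iota => r1 /mem_runner xr.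
  by rewrite /= /P xr; lia.
have mid0 k : all (predC P) (mid k).
  apply/allP => x /mapP[i]; rewrite mem_iota /L => i1 ->.
  by rewrite /= /P modn_col; lia.
have end1 k : P (k * t + a)%N by rewrite /P modn_col ?eqxx //; lia.
have end2 k : P (k * t + (t - a))%N.
  by rewrite /P modn_col ?eqxx ?orbT //; lia.
have nP s : all P s -> [seq x <- s | predC P x] = [::].
  by move=> Ps; apply: filter_none; apply: sub_all Ps => x /= ->.
have rowsP : filter P (strip a) = run a ++ run (t - a).
  rewrite rowsE !filter_cat (all_filterP run1) (filter_none strip0).
  by rewrite (all_filterP run2).
have rowsN : filter (predC P) (strip a) = strip a.+1.
  by rewrite rowsE !filter_cat (nP _ run1) (nP _ run2) (all_filterP strip0) cats0.
have colsP : filter P (strip_cols a) = pair_cols a.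
  rewrite colsE filter_flatten -map_comp; congr flatten; apply: eq_map => k.
  by rewrite /= end1 filter_cat (filter_none (mid0 k)) /= end2.
have colsN : filter (predC P) (strip_cols a) = strip_cols a.+1.
  rewrite colsE filter_flatten -map_comp; congr flatten; apply: eq_map => k.
  by rewrite /= end1 filter_cat (all_filterP (mid0 k)) /= end2 cats0.
have invs_rows : invs P (strip a) = (size (strip a.+1) * m (t - a))%N.
  rewrite rowsE !invs_cat (invs_all run1) (invs_all run2) (invs_none strip0).
  rewrite (count_none (P := predC P) (s := run a)); last first.
    by apply: sub_all run1 => x /= ->.
  by rewrite (count_all strip0) (count_all run2) size_runner mul0n addn0.
have invs_cols : invs P (strip_cols a) = (n * L + 'C(n, 2) * (L * 2))%N.
  rewrite colsE; apply: invs_periodic => k.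
  rewrite /per /= invs_cat !count_cat (invs_none (mid0 k)).
  rewrite (count_none (mid0 k)) (count_all (mid0 k)) /= end1 end2.
  by rewrite size_map size_iota; split; lia.
rewrite (@sdet_split _ _ _ P P); last first.
  move=> x c; apply: contraNeq => /o_entry_supp; rewrite /P.
  by have := ltn_pmod x t0; have := ltn_pmod c t0; lia.
rewrite rowsP rowsN colsP colsN invs_rows invs_cols.
have [sz|/sdet_size->] := eqVneq (size (strip a.+1)) (size (strip_cols a.+1)).
  congr (_ * _ * _); rewrite sz size_strip_cols -/L -signr_odd -[RHS]signr_odd.
  congr (_ ^+ nat_of_bool _).
  have oL : odd L = odd t.-1 by rewrite /L; lia.
  rewrite !(oddD, oddM) /= oL.
  by case: (odd n); case: (odd t.-1); case: (odd (m _)); rewrite ?andbF.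
by rewrite !mulr0.
Qed.

Lemma peel_pairs u : (u.*2 < t)%N ->
  sdet o_entry (strip 1) (strip_cols 1) =
  \prod_(1 <= a < u.+1) ((-1) ^+ (n * t.-1 * (m (t - a)).+1)
    * sdet o_entry (run a ++ run (t - a)) (pair_cols a))
  * sdet o_entry (strip u.+1) (strip_cols u.+1).
Proof.
elim: u => [|u IH] ut; first by rewrite big_nil mul1r.
rewrite IH; last by lia.
rewrite (peel_pair (ltn0Sn u) ut) mulrA; congr (_ * _).
by rewrite [RHS]big_nat_recr.
Qed.

Let u := ((t - 1) %/ 2)%N.

Lemma strip_last_odd : odd t ->
  sdet o_entry (strip u.+1) (strip_cols u.+1) = 1.
Proof.
move=> to; have E : (t + 1 - u.+1.*2 = 0)%N by rewrite /u; lia.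
rewrite /strip /strip_cols E /=; elim: (iota 0 n) => //=.
Qed.

Lemma strip_last_even : ~~ odd t -> sdet o_entry (strip u.+1) (strip_cols u.+1) =
  sdet o_entry (run u.+1) (mkseq (fun j => j * t + u.+1)%N n).
Proof.
move=> te; have E : (t + 1 - u.+1.*2 = 1)%N by rewrite /u; lia.
rewrite /strip /strip_cols E /= cats0.
by rewrite -[mkseq _ _]flatten_seq1 /mkseq -map_comp.
Qed.

(** No condition on the core is made: non-square blocks enter as 0, so this one factorisation yields
    both the vanishing and the formula. *)
Lemma phi_o_char : (size la <= N)%N ->
  phi (o_char la) = (-1) ^+ wt t la N * (-1) ^+ (t.-1 * 'C(n.+1, 2))
  * sdet o_entry (run 0) (mkseq (fun j => j.+1 * t)%N n)
  * \prod_(1 <= a < u.+1) ((-1) ^+ (n * t.-1 * (m (t - a)).+1)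
      * sdet o_entry (run a ++ run (t - a)) (pair_cols a))
  * sdet o_entry (strip u.+1) (strip_cols u.+1).
Proof.
move=> laN; rewrite (o_char_det laP laN) -det_map_mx.
have -> : \det (map_mx phi (\matrix_(i < N, j < N)
      (hsymz ((part la i)%:Z - i.+1%:Z + j.+1%:Z)
       - hsymz ((part la i)%:Z - i.+1%:Z - j.+1%:Z)))) =
    sdet o_entry (beta_seq la N) (iota 1 N).
  rewrite (iotaDl 1 0) (sdet_mkseq _ _ succn); congr (\det _).
  apply/matrixP => i j; rewrite !mxE rmorphB /o_entry /=.
  by have iN := ltn_ord i; congr (phi (hsymz _) - phi (hsymz _)); lia.
rewrite (sdet_beta_runners N t0 laP) peel_zero (@peel_pairs u); last by rewrite /u; lia.
by rewrite !mulrA.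
Qed.

Lemma phi_o_char_eq0 : (size la <= N)%N ->
  ~~ orthogonal_part (tcore t la N) -> phi (o_char la) = 0.
Proof.
move=> laN; apply: contraNeq => nz; apply/orthogonal_tcore => //.
have {nz} := nz; rewrite phi_o_char //.
have [m0|/eqP m0] := eqVneq (m 0) n; last first.
  rewrite [sdet o_entry (run 0) _]sdet_size ?mulr0 ?mul0r ?eqxx //.
  by rewrite size_runner size_mkseq; apply/eqP.
move=> nz; split=> // r rt.
suff H a : (0 < a)%N -> (a.*2 <= t)%N -> (m a + m (t - a) = n.*2)%N.
  have [r2|r2] := leqP r.*2 t; first by apply: H; lia.
  have := H (t - r)%N; rewrite subKn ?(addnC (m (t - r))); last by lia.
  by move=> -> //; lia.
(* If t = 2a, the two residues coincide, and it is the last block, with n columns, that gives m_a =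
   n. *)
move=> a0; rewrite leq_eqVlt => /predU1P[at2|at2].
  have te : ~~ odd t by rewrite -at2 odd_double.
  have ua : u.+1 = a by rewrite /u; lia.
  have -> : (t - a = a)%N by lia.
  rewrite addnn; congr _.*2; apply/eqP; apply: contraNT nz => ma.
  by rewrite strip_last_even // ua [X in _ * X]sdet_size ?mulr0 // size_runner size_mkseq.
apply/eqP; apply: contraNT nz => ma.
rewrite (bigD1_seq a) ?iota_uniq //=; last by rewrite mem_index_iota /u; lia.
rewrite [sdet o_entry (run a ++ _) _]sdet_size ?(mulr0, mul0r) //.
rewrite size_cat !size_runner /pair_cols size_flatten /shape -map_comp.
rewrite sumnE big_map /= big_const_seq count_predT size_iota iter_addn_0 mul2n.
by [].
Qed.

(** * Comparison of the collected sign with epsilon *)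

Lemma sum_from_top (F : nat -> nat) k l : (k <= l)%N ->
  (\sum_(l - k <= r < l) F r = \sum_(1 <= j < k.+1) F (l - j))%N.
Proof.
elim: k => [|k IH] kl; first by rewrite subn0 !big_geq.
rewrite big_ltn ?[RHS]big_nat_recr //=; last by lia.
by rewrite (_ : (l - k.+1).+1 = (l - k)%N) ?IH 1?addnC //; lia.
Qed.

Lemma odd_sum (F G : nat -> nat) k l :
  (forall i, (k <= i < l)%N -> odd (F i) = odd (G i)) ->
  odd (\sum_(k <= i < l) F i) = odd (\sum_(k <= i < l) G i).
Proof.
move=> FG; rewrite !(big_morph odd oddD (erefl _)) big_nat [RHS]big_nat.
exact: eq_bigr.
Qed.

(** The rank is the sum of the positive parts of the m_r - n. In a pair of residues these
    differences are opposite, so the pair contributes their common absolute value, congruent to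
    m_(t-a) + n modulo 2; the residues 0 and t/2 contribute nothing. *)
Lemma odd_frob_rank : m 0 = n ->
  (forall r, (0 < r < t)%N -> (m r + m (t - r) = n.*2)%N) ->
  odd (frob_rank (tcore t la N)) =
  odd (\sum_(1 <= a < u.+1) (m (t - a) + n)).
Proof.
move=> m0 mr; rewrite frob_rank_tcore // -/N big_ltn // m0 subnn add0n.
rewrite (@big_cat_nat _ _ _ u.+1) /=; [|by []|by rewrite /u; lia].
rewrite (@big_cat_nat _ _ _ (t - u) u.+1) /=; [|by rewrite /u; lia|by rewrite /u; lia].
rewrite [X in (_ + (X + _))%N](_ : _ = 0%N) ?add0n; last first.
  rewrite big_nat big1 // => r ru.
  have r1 : (0 < r < t)%N by move: ru; rewrite /u; lia.
  have := mr r r1; rewrite (_ : (t - r = r)%N); last by move: ru; rewrite /u; lia.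
  by lia.
rewrite sum_from_top; last by rewrite /u; lia.
rewrite -big_split /=; apply: odd_sum => a au.
have a1 : (0 < a < t)%N by move: au; rewrite /u; lia.
by have := mr a a1; lia.
Qed.

(** Modulo 2, C(m+1,2) = C(m,2) + m, and the parity of the rank turns the first two terms of epsilon
    into the sum of the C(m_(t-a),2) + n. For t even, n^2 = n turns n times the rank into the sum of
    the n(m_(t-a) + 1); for t odd, the factor t - 1 is even and removes the corresponding terms. *)
Lemma odd_eps_o : m 0 = n ->
  (forall r, (0 < r < t)%N -> (m r + m (t - r) = n.*2)%N) ->
  odd (eps_o t n la) = odd (t.-1 * 'C(n.+1, 2) + \sum_(1 <= a < u.+1)
    (n * t.-1 * (m (t - a)).+1 + (n + 'C(m (t - a), 2)))).
Proof.
move=> m0 mr; have := odd_frob_rank m0 mr; rewrite /eps_o -/N.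
move: (frob_rank _) => k.
have -> : ((t + 2) %/ 2 = t - u)%N by rewrite /u; lia.
rewrite sum_from_top; last by rewrite /u; lia.
under [in X in _ -> X = _]eq_bigr => a _ do rewrite binS bin1.
rewrite !big_split /= -big_distrr /=.
have -> : (\sum_(1 <= a < u.+1) (m (t - a)).+1 =
    \sum_(1 <= a < u.+1) m (t - a) + u)%N.
  under eq_bigr => a _ do rewrite -addn1.
  by rewrite big_split /= sum_nat_const_nat subn1 muln1.
rewrite sum_nat_const_nat subn1 /=.
move: (\sum_(_ <= _ < _) _)%N (\sum_(_ <= _ < _) _)%N ('C(_, _)) => S1 S2 C.
case: (boolP (odd t)) => to; rewrite !(oddD, oddM) => ->.
  have -> : odd t.-1 = false by lia.
  by case: (odd n); case: (odd u); case: (odd S1); case: (odd S2).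
have -> : odd t.-1 by lia.
rewrite /=.
by case: (odd n); case: (odd u); case: (odd S1); case: (odd S2); case: (odd C).
Qed.

Lemma phi_o_char_orthogonal : (size la <= N)%N ->
  orthogonal_part (tcore t la N) ->
  phi (o_char la) = (-1) ^+ eps_o t n la * (-1) ^+ wt t la N * o_char (q 0)
    * (\prod_(1 <= r < u.+1) rs_char (q r) (q (t - r)))
    * (if odd t then 1 else som_char (q (t %/ 2))).
Proof.
move=> laN /orthogonal_tcore-/(_ t0 laP); rewrite -/N => -[m0 mr].
rewrite phi_o_char //.
rewrite block_zero //.
have -> : sdet o_entry (strip u.+1) (strip_cols u.+1) =
    if odd t then 1 else som_char (q (t %/ 2)).
  case: ifP => [/strip_last_odd //|/negbT te].
  have th : (t = u.+1.*2)%N by rewrite /u; lia.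
  have uE : (t %/ 2 = u.+1)%N by lia.
  rewrite strip_last_even // uE block_half //.
  have u1 : (0 < u.+1 < t)%N by lia.
  by have := mr _ u1; rewrite (_ : (t - u.+1 = u.+1)%N); lia.
rewrite -[(-1) ^+ eps_o t n la]signr_odd odd_eps_o // signr_odd exprD.
have -> : \prod_(1 <= a < u.+1) ((-1) ^+ (n * t.-1 * (m (t - a)).+1)
      * sdet o_entry (run a ++ run (t - a)) (pair_cols a)) =
    (-1) ^+ (\sum_(1 <= a < u.+1)
      (n * t.-1 * (m (t - a)).+1 + (n + 'C(m (t - a), 2))))
    * \prod_(1 <= r < u.+1) rs_char (q r) (q (t - r)).
  rewrite -prodrXr -big_split /= big_nat [RHS]big_nat; apply: eq_bigr => a au.
  have at2 : (a.*2 < t)%N by move: au; rewrite /u; lia.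
  rewrite block_pair ?exprD ?mulrA //; first by case/andP: au.
  by apply: mr; lia.
move: (o_char _) (\prod_(_ <= _ < _) _) (if _ then _ else _) => O P S.
by move: (_ ^+ _) (_ ^+ _) (_ ^+ _) => x y z; ring.
Qed.
End Factorisation.

Theorem theorem3p2 (t n : nat) (la : seq nat) (phi : {rmorphism symfun -> symfun})
    (ht : (2 <= t)%N) (hn : (0 < n)%N)
    (hla : is_part la) (hlen : (size la <= n * t)%N)
    (hphi : forall r : nat,
       phi (hsym r) = if (t %| r)%N then hsym (r %/ t) else 0) :
  (~~ orthogonal_part (tcore t la (n * t)) -> phi (o_char la) = 0) /\
  (orthogonal_part (tcore t la (n * t)) ->
     phi (o_char la) =
       (-1) ^+ eps_o t n la * (-1) ^+ wt t la (n * t)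
       * o_char (tquot t la (n * t) 0)
       * (\prod_(1 <= r < ((t - 1) %/ 2).+1)
            rs_char (tquot t la (n * t) r) (tquot t la (n * t) (t - r)))
       * (if odd t then 1 else som_char (tquot t la (n * t) (t %/ 2)))).
Proof.
split; first exact: phi_o_char_eq0.
exact: phi_o_char_orthogonal.
Qed.
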